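(* Every lower (resp. upper) semicontinuous piecewise polynomial function $f:\mathbb{R}^n\to\mathbb{R}$ is the optimistic (resp. pessimistic) value function of a polynomial bilevel problem whose lower-level objective is convex in the lower-level variable over a bounded box. That is, $$\mathcal{PP}\cap\mathcal{LSC}\subseteq\mathcal{C}^{\mathrm{optim}}_{\mathrm{bounded}}\subseteq\mathcal{SA}\cap\mathcal{LSC}\cap\mathcal{CB},\qquad \mathcal{PP}\cap\mathcal{USC}\subseteq\mathcal{C}^{\mathrm{pessim}}_{\mathrm{bounded}}\subseteq\mathcal{SA}\cap\mathcal{USC}\cap\mathcal{CB}.$$
   Context: Bilevel data: polynomials $P,Q:\mathbb{R}^n\times\mathbb{R}^m\to\mathbb{R}$ and a box $\mathcal{Y}=[a_1,b_1]\times\cdots\times[a_m,b_m]$, bounded if all $a_i,b_i\in\mathbb{R}$. $\Theta(x):=\arg\min_{y\in\mathcal{Y}}Q(x,y)$; $\varphi_o(x)=\inf_{y\in\Theta(x)}P(x,y)$, $\varphi_p(x)=\sup_{y\in\Theta(x)}P(x,y)$, with $\varphi_o=+\infty$, $\varphi_p=-\infty$ when $\Theta(x)=\emptyset$. $\mathcal{C}^{\mathrm{optim}}_{\mathrm{bounded}}$ (resp. $\mathcal{C}^{\mathrm{pessim}}_{\mathrm{bounded}}$) is the set of functions $h$ on $\mathbb{R}^n$ for which there exist $m$, polynomials $P,Q$ with $Q(x,\cdot)$ convex for each $x$, and a bounded box $\mathcal{Y}$ with $\varphi_o=h$ (resp. $\varphi_p=h$). $\mathcal{PP}$: piecewise polynomial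 functions, i.e. $f:\mathbb{R}^n\to\mathbb{R}$ for which there are a partition of $\mathbb{R}^n$ into finitely many pairwise disjoint semi-algebraic sets $S_1,\dots,S_N$ and polynomials $P_i$ with $f=P_i$ on $S_i$. Semi-algebraic sets: finite unions of sets $\{P=0,\ Q_j>0,\ j\in J\}$ with polynomials $P,Q_j$. $\mathcal{SA}$: extended-real-valued semi-algebraic functions. $\mathcal{LSC}$, $\mathcal{USC}$: lower/upper semicontinuous functions. $\mathcal{CB}$: real-valued functions bounded on every compact set. *)

(* Defs.v *)
From mathcomp Require Import all_boot all_order all_algebra.
From mathcomp Require Import all_classical all_reals all_analysis.
(* Not imported: the notations of mpoly clash with those of MathComp-Analysis. *)
From mathcomp.multinomials Require mpoly.

Set Implicit Arguments.
Unset Strict Implicit.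
Unset Printing Implicit Defensive.

Import Order.TTheory GRing.Theory Num.Theory.
Import numFieldNormedType.Exports.

Local Open Scope classical_set_scope.
Local Open Scope ring_scope.

Definition poly_in (R : realType) (n : nat) := mpoly.mpoly n R.

Definition peval (R : realType) (n : nat) (p : poly_in R n) (x : 'rV[R]_n) : R :=
  mpoly.meval (fun i => x ord0 i) p.

Definition peval2 (R : realType) (n m : nat) (p : poly_in R (n + m))
    (x : 'rV[R]_n) (y : 'rV[R]_m) : R :=
  peval p (row_mx x y).

(* {P = 0, Q_j > 0, j in J}, with the finite family (Q_j)_j given as a list *)
Definition basic_semialgebraic (R : realType) (n : nat)
    (P : poly_in R n) (Q : seq (poly_in R n)) : set 'rV[R]_n :=
  [set x | peval P x = 0 /\ forall j, (j < size Q)%N -> 0 < peval (nth P Q j) x].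

Definition semialgebraic (R : realType) (n : nat) (A : set 'rV[R]_n) : Prop :=
  exists (N : nat) (P : 'I_N -> poly_in R n) (Q : 'I_N -> seq (poly_in R n)),
    A = \bigcup_(k in [set: 'I_N]) basic_semialgebraic (P k) (Q k).

Definition piecewise_polynomial (R : realType) (n : nat)
    (f : 'rV[R]_n -> R) : Prop :=
  exists (N : nat) (S : 'I_N -> set 'rV[R]_n) (P : 'I_N -> poly_in R n),
    [/\ partition [set: 'I_N] S [set: 'rV[R]_n],
        forall i, semialgebraic (S i)
      & forall i x, S i x -> f x = peval (P i) x].

(* All the function classes live in R^n -> \bar R, so that they can be
   compared; real-valued functions are embedded through EFin. *)
Definition PP (R : realType) (n : nat) : set ('rV[R]_n -> \bar R) :=
  [set h | exists2 f : 'rV[R]_n -> R, piecewise_polynomial f & h = EFin \o f].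

(* The finite part of the graph is a subset of R^n x R = R^(n+1); the places
   where the values +oo and -oo are taken have to be semi-algebraic too. *)
Definition SA (R : realType) (n : nat) : set ('rV[R]_n -> \bar R) :=
  [set h | [/\ semialgebraic
                 [set z : 'rV[R]_(n + 1) | h (lsubmx z) = (rsubmx z ord0 ord0)%:E],
               semialgebraic [set x | h x = +oo%E]
             & semialgebraic [set x | h x = -oo%E]]].

Definition LSC (R : realType) (n : nat) : set ('rV[R]_n -> \bar R) :=
  [set h | lower_semicontinuous h].

Definition upper_semicontinuous (X : topologicalType) (R : numFieldType)
    (f : X -> \bar R) : Prop :=
  forall x a, (f x < a%:E)%E ->
    exists2 V, nbhs x V & forall y, V y -> (f y < a%:E)%E.

Definition USC (R : realType) (n : nat) : set ('rV[R]_n -> \bar R) :=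
  [set h | upper_semicontinuous h].

Definition CB (R : realType) (n : nat) : set ('rV[R]_n -> \bar R) :=
  [set h | exists2 f : 'rV[R]_n -> R, h = EFin \o f &
     forall K : set 'rV[R]_n, compact K ->
       exists M : R, forall x, K x -> `|f x| <= M].

(* Intervals [a_i, b_i] are nonempty. *)
Definition bounded_box (R : realType) (m : nat) (Y : set 'rV[R]_m) : Prop :=
  exists a b : 'I_m -> R, (forall i, a i <= b i) /\
    Y = [set y | forall i, a i <= y ord0 i <= b i].

(* Theta(x) = argmin of Q(x, .) over Y *)
Definition lower_argmin (R : realType) (n m : nat) (Q : poly_in R (n + m))
    (Y : set 'rV[R]_m) (x : 'rV[R]_n) : set 'rV[R]_m :=
  [set y | Y y /\ forall z, Y z -> peval2 Q x y <= peval2 Q x z].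

(* ereal_inf set0 = +oo and ereal_sup set0 = -oo, the values prescribed when
   the argmin is empty *)
Definition optimistic_value (R : realType) (n m : nat) (P Q : poly_in R (n + m))
    (Y : set 'rV[R]_m) (x : 'rV[R]_n) : \bar R :=
  ereal_inf [set (peval2 P x y)%:E | y in lower_argmin Q Y x].

Definition pessimistic_value (R : realType) (n m : nat) (P Q : poly_in R (n + m))
    (Y : set 'rV[R]_m) (x : 'rV[R]_n) : \bar R :=
  ereal_sup [set (peval2 P x y)%:E | y in lower_argmin Q Y x].

(* Convexity of Q(x, .) is required on the whole of R^m, not only on the box. *)
Definition C_optim_bounded (R : realType) (n : nat) : set ('rV[R]_n -> \bar R) :=
  [set h | exists (m : nat) (P Q : poly_in R (n + m)) (Y : set 'rV[R]_m),
     [/\ forall x, convex_function [set: 'rV[R]_m] (peval2 Q x),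
         bounded_box Y
       & optimistic_value P Q Y = h]].

Definition C_pessim_bounded (R : realType) (n : nat) : set ('rV[R]_n -> \bar R) :=
  [set h | exists (m : nat) (P Q : poly_in R (n + m)) (Y : set 'rV[R]_m),
     [/\ forall x, convex_function [set: 'rV[R]_m] (peval2 Q x),
         bounded_box Y
       & pessimistic_value P Q Y = h]].

(* Main.v *)
(* Lower level. With Q(x, y) = sum_k g_k(x) y_k on [0, 1]^m, a minimizer has
   y_k = 0 where g_k > 0 and y_k = 1 where g_k < 0, while y_k is free where g_k = 0.
   Combining such y_k by products and by u + v - u v yields, for every D that is a
   finite Boolean combination without negation of sets {g <= 0}, a polynomial in y which
   vanishes off D and can be made equal to 1 on D. By the finiteness theorem, which
   follows from quantifier elimination through a Lojasiewicz inequality, these D are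
   exactly the closed semialgebraic sets.

   If f is lower semicontinuous and f = P_i on S_i, then D_i = {f <= P_i} is closed and
   f(x) is the minimum of the P_i(x) with x in D_i. Starting from a polynomial above f,
   the upper level replaces v by v + w_i t_i (P_i - v) for each i in turn, where t_i is
   the indicator of D_i and w_i is a free variable of [0, 1]; the minimum over the
   lower-level solutions is then f.

   Conversely the value function is described by a first-order formula, and the
   compactness of the box gives semicontinuity and local boundedness. The pessimistic
   case follows by changing the signs of P and f. *)

Require Import Defs.
From mathcomp Require Import all_boot all_order all_algebra.
From mathcomp Require Import all_classical all_reals all_analysis.
From mathcomp Require Import ring lra.
From mathcomp Require ordered_qelim qe_rcf.

Set Implicit Arguments.
Unset Strict Implicit.
Unset Printing Implicit Defensive.

Import Order.TTheory GRing.Theory Num.Theory.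
Import numFieldNormedType.Exports.

Local Open Scope classical_set_scope.
Local Open Scope ring_scope.
Local Open Scope convex_scope.

(** * Polynomial functions *)

Section PolynomialFunctions.
Context {R : realType}.

(** Polynomials are handled as functions, so that substitutions and changes of variables are checked
    pointwise rather than on formal polynomials. *)
Definition polyfun n (F : 'rV[R]_n -> R) := exists p : poly_in R n, peval p = F.

Lemma polyfun_peval n (p : poly_in R n) : polyfun (peval p).
Proof. by exists p. Qed.

Lemma polyfun_cst n (c : R) : @polyfun n (fun _ : 'rV[R]_n => c).
Proof. by exists (mpoly.mpolyC n c); apply/funext => x; exact: mpoly.mevalC. Qed.

Lemma polyfun_coord n (i : 'I_n) : polyfun (fun x : 'rV[R]_n => x ord0 i).
Proof.
by exists (mpoly.mpolyX R (mpoly.mnm1 i)); apply/funext => x; exact: mpoly.mevalXU.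
Qed.

Lemma polyfunD n (F G : 'rV[R]_n -> R) :
  polyfun F -> polyfun G -> polyfun (fun x => F x + G x).
Proof.
by move=> [p <-] [q <-]; eexists; apply/funext => x; exact: mpoly.mevalD.
Qed.

Lemma polyfunM n (F G : 'rV[R]_n -> R) :
  polyfun F -> polyfun G -> polyfun (fun x => F x * G x).
Proof.
by move=> [p <-] [q <-]; eexists; apply/funext => x; exact: mpoly.mevalM.
Qed.

Lemma polyfunN n (F : 'rV[R]_n -> R) : polyfun F -> polyfun (fun x => - F x).
Proof.
by move=> [p <-]; eexists; apply/funext => x; exact: mpoly.mevalN.
Qed.

Lemma polyfunB n (F G : 'rV[R]_n -> R) :
  polyfun F -> polyfun G -> polyfun (fun x => F x - G x).
Proof. by move=> pF pG; apply: polyfunD => //; exact: polyfunN. Qed.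

Lemma eq_polyfun n (F G : 'rV[R]_n -> R) : polyfun F -> F =1 G -> polyfun G.
Proof. by move=> pF /funext <-. Qed.

Lemma polyfunX n (F : 'rV[R]_n -> R) k :
  polyfun F -> polyfun (fun x => F x ^+ k).
Proof.
move=> pF; elim: k => [|k ih]; first exact: polyfun_cst.
by apply: eq_polyfun (polyfunM pF ih) _ => x; rewrite exprS.
Qed.

Lemma polyfun_sum n (I : Type) (r : seq I) (F : I -> 'rV[R]_n -> R) :
  (forall i, polyfun (F i)) -> polyfun (fun x => \sum_(i <- r) F i x).
Proof.
move=> pF; elim: r => [|i r ih].
  by apply: eq_polyfun (polyfun_cst _ 0) _ => x; rewrite big_nil.
by apply: eq_polyfun (polyfunD (pF i) ih) _ => x; rewrite big_cons.
Qed.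

Lemma polyfun_prod n (I : Type) (r : seq I) (F : I -> 'rV[R]_n -> R) :
  (forall i, polyfun (F i)) -> polyfun (fun x => \prod_(i <- r) F i x).
Proof.
move=> pF; elim: r => [|i r ih].
  by apply: eq_polyfun (polyfun_cst _ 1) _ => x; rewrite big_nil.
by apply: eq_polyfun (polyfunM (pF i) ih) _ => x; rewrite big_cons.
Qed.

(** The monomial expansion of a polynomial generates it from constants and coordinates by sums and
    products. Composition, continuity, boundedness and the translations to other encodings all go
    through this principle. *)
Lemma polyfun_ind n (K : ('rV[R]_n -> R) -> Prop) :
  (forall c, K (fun=> c)) -> (forall i, K (fun x => x ord0 i)) ->
  (forall F G, K F -> K G -> K (fun x => F x + G x)) ->
  (forall F G, K F -> K G -> K (fun x => F x * G x)) ->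
  forall F, polyfun F -> K F.
Proof.
move=> Kc Kx Kadd Kmul _ [p <-].
have Keq F G : K F -> F =1 G -> K G by move=> KF /funext <-.
have Kprod (r : seq 'I_n) (m : 'I_n -> nat) :
    K (fun x => \prod_(i <- r) x ord0 i ^+ m i).
  elim: r => [|i r ih].
    by apply: Keq (Kc 1) _ => x; rewrite big_nil.
  have Kexp : K (fun x => x ord0 i ^+ m i).
    elim: (m i) => [|k ihk]; first exact: Kc.
    by apply: Keq (Kmul _ _ (Kx i) ihk) _ => x; rewrite exprS.
  by apply: Keq (Kmul _ _ Kexp ih) _ => x; rewrite big_cons.
have Ksum (r : seq (mpoly.multinom n)) : K (fun x => \sum_(m <- r)
    mpoly.mcoeff m p *
      \prod_(i <- index_enum 'I_n) x ord0 i ^+ mpoly.fun_of_multinom m i).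
  elim: r => [|m r ih].
    by apply: Keq (Kc 0) _ => x; rewrite big_nil.
  have Km := Kmul _ _ (Kc (mpoly.mcoeff m p))
    (Kprod (index_enum _) (mpoly.fun_of_multinom m)).
  by apply: Keq (Kadd _ _ Km ih) _ => x; rewrite big_cons.
by apply: Keq (Ksum (mpoly.msupp p)) _ => x; rewrite /peval mpoly.mevalE.
Qed.

Definition polymap n k (X : 'rV[R]_n -> 'rV[R]_k) :=
  forall i, polyfun (fun x => X x ord0 i).

Lemma polyfun_comp n k (F : 'rV[R]_k -> R) (X : 'rV[R]_n -> 'rV[R]_k) :
  polyfun F -> polymap X -> polyfun (fun x => F (X x)).
Proof.
move=> pF pX; pattern F; apply: polyfun_ind pF => //.
- by move=> c; exact: polyfun_cst.
- by move=> G H; exact: polyfunD.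
- by move=> G H; exact: polyfunM.
Qed.

Lemma polymap_id n : polymap (fun x : 'rV[R]_n => x).
Proof. by move=> i; exact: polyfun_coord. Qed.

Lemma polymap_lsubmx n k l (X : 'rV[R]_n -> 'rV[R]_(k + l)) :
  polymap X -> polymap (fun z => lsubmx (X z)).
Proof. by move=> pX i; apply: eq_polyfun (pX (lshift l i)) _ => z; rewrite mxE. Qed.

Lemma polymap_rsubmx n k l (X : 'rV[R]_n -> 'rV[R]_(k + l)) :
  polymap X -> polymap (fun z => rsubmx (X z)).
Proof. by move=> pX i; apply: eq_polyfun (pX (rshift k i)) _ => z; rewrite mxE. Qed.

Lemma polymap_row_mx n k l (X : 'rV[R]_n -> 'rV[R]_k) (Y : 'rV[R]_n -> 'rV[R]_l) :
  polymap X -> polymap Y -> polymap (fun z => row_mx (X z) (Y z)).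
Proof.
move=> pX pY i; case: (split_ordP i) => j ->.
- by apply: eq_polyfun (pX j) _ => z; rewrite row_mxEl.
- by apply: eq_polyfun (pY j) _ => z; rewrite row_mxEr.
Qed.

Lemma polymap_cst n k (c : 'rV[R]_k) : polymap (fun _ : 'rV[R]_n => c).
Proof. by move=> i; exact: polyfun_cst. Qed.

Lemma polyfun_continuous n (F : 'rV[R]_n -> R) : polyfun F -> continuous F.
Proof.
move: F; apply: polyfun_ind => [c|i|F G cF cG|F G cF cG] x.
- exact: cst_continuous.
- exact: coord_continuous.
- by apply: continuousD; [exact: cF|exact: cG].
- by apply: continuousM; [exact: cF|exact: cG].
Qed.

Lemma polyfun_bounded n (F : 'rV[R]_n -> R) (B : R) : polyfun F ->
  exists M, forall z : 'rV[R]_n, (forall i, `|z ord0 i| <= B) -> `|F z| <= M.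
Proof.
move: F; apply: polyfun_ind => [c|i|F G [M FM] [N GN]|F G [M FM] [N GN]].
- by exists `|c|.
- by exists B.
- exists (M + N) => z zB; apply: le_trans (ler_normD _ _) _.
  by apply: lerD; [exact: FM|exact: GN].
- exists (M * N) => z zB; rewrite normrM.
  by apply: ler_pM => //; [exact: FM|exact: GN].
Qed.

End PolynomialFunctions.

(** * Semialgebraic sets *)

Section SemialgebraicSets.
Context {R : realType}.
Implicit Types n k l : nat.

Definition basic_holds n (b : poly_in R n * seq (poly_in R n)) (x : 'rV[R]_n) :=
  (peval b.1 x == 0) && all (fun q => 0 < peval q x) b.2.

(** A list of pieces with a Boolean membership test allows the closure properties to be proved by
    induction on the list. *)
Lemma semialgebraicP n (A : set 'rV[R]_n) : semialgebraic A <->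
  exists s : seq (poly_in R n * seq (poly_in R n)),
    forall x, A x <-> has (fun b => basic_holds b x) s.
Proof.
pose b0 := (mpoly.mpolyC n (0 : R), [::] : seq (poly_in R n)).
have basicP (p : poly_in R n) q x :
    basic_semialgebraic p q x <-> basic_holds (p, q) x.
  split=> [[/eqP p0 q0]|/andP[/eqP p0 /all_nthP q0]].
  - by rewrite /basic_holds /= p0; exact/(all_nthP p).
  - by split=> // j /(q0 p).
split=> [[N [P [Q ->]]]|[s As]].
- exists [seq (P i, Q i) | i <- enum 'I_N] => x; rewrite has_map; split.
  + move=> [i _ /basicP Bx]; apply/hasP; exists i => //; exact: mem_enum.
  + by move=> /hasP[i _ /basicP Bx]; exists i.
- exists (size s), (fun i => (tnth (in_tuple s) i).1),
    (fun i => (tnth (in_tuple s) i).2).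
  apply/seteqP; split=> x.
  + move=> /As /(has_nthP b0)[i si Bx].
    exists (Ordinal si) => //; apply/basicP.
    by rewrite -surjective_pairing (tnth_nth b0).
  + move=> [i _ /basicP]; rewrite -surjective_pairing => Bx; apply/As.
    apply/(has_nthP b0); exists (nat_of_ord i) => //.
    by rewrite -(tnth_nth _ (in_tuple s)).
Qed.


Lemma semialgebraic_pos n (F : 'rV[R]_n -> R) :
  polyfun F -> semialgebraic [set x | 0 < F x].
Proof.
move=> [p <-]; apply/semialgebraicP; exists [:: (mpoly.mpolyC n 0, [:: p])] => x.
by rewrite /= orbF /basic_holds /= /peval mpoly.mevalC eqxx andbT.
Qed.

Lemma semialgebraic_zero n (F : 'rV[R]_n -> R) :
  polyfun F -> semialgebraic [set x | F x = 0].
Proof.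
move=> [p <-]; apply/semialgebraicP; exists [:: (p, [::])] => x.
by rewrite /= orbF /basic_holds /= andbT; split=> /eqP.
Qed.

Lemma semialgebraic0 n : semialgebraic (set0 : set 'rV[R]_n).
Proof. by apply/semialgebraicP; exists [::]. Qed.

Lemma semialgebraicT n : semialgebraic (setT : set 'rV[R]_n).
Proof.
have := semialgebraic_zero (polyfun_cst n (0 : R)).
by congr semialgebraic; apply/seteqP; split.
Qed.

Lemma semialgebraicU n (A B : set 'rV[R]_n) :
  semialgebraic A -> semialgebraic B -> semialgebraic (A `|` B).
Proof.
move=> /semialgebraicP[s As] /semialgebraicP[t Bt].
apply/semialgebraicP; exists (s ++ t) => x; rewrite has_cat.
by split=> [[/As|/Bt] ->|/orP[/As|/Bt]]; rewrite ?orbT //; [left|right].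
Qed.

(** Two equations merge into one through a sum of squares. *)
Lemma basic_holdsI n (b c : poly_in R n * seq (poly_in R n)) :
  exists d, forall x, basic_holds d x = basic_holds b x && basic_holds c x.
Proof.
have [p pE] : polyfun (fun x => peval b.1 x ^+ 2 + peval c.1 x ^+ 2).
  by apply: polyfunD; apply: polyfunX; exact: polyfun_peval.
exists (p, b.2 ++ c.2) => x; rewrite /basic_holds /= pE all_cat.
by rewrite paddr_eq0 ?sqr_ge0 // !sqrf_eq0 !andbA; congr (_ && _); rewrite andbAC.
Qed.

Lemma semialgebraicI n (A B : set 'rV[R]_n) :
  semialgebraic A -> semialgebraic B -> semialgebraic (A `&` B).
Proof.
move=> /semialgebraicP[s As] /semialgebraicP[t Bt].
suff [u uE] : exists u : seq (poly_in R n * seq (poly_in R n)), forall x,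
    has (fun b => basic_holds b x) u =
    has (fun b => basic_holds b x) s && has (fun b => basic_holds b x) t.
  apply/semialgebraicP; exists u => x; rewrite uE.
  by split=> [[/As -> /Bt]|/andP[/As ? /Bt]].
elim: s {A As} => [|b s [u uE]]; first by exists [::].
suff [v vE] : exists v : seq (poly_in R n * seq (poly_in R n)), forall x,
    has (fun b => basic_holds b x) v =
    basic_holds b x && has (fun b => basic_holds b x) t.
  by exists (v ++ u) => x; rewrite has_cat uE vE andb_orl.
elim: t {B Bt s u uE} => [|c t [v vE]]; first by exists [::] => x; rewrite andbF.
have [d dE] := basic_holdsI b c.
by exists (d :: v) => x; rewrite /= dE vE andb_orr.
Qed.

(** By De Morgan it suffices to negate atoms: [p != 0] is [0 < p ^+ 2], and the negation of [0 < p]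
    is [p = 0] or [0 < - p]. *)
Lemma semialgebraicC n (A : set 'rV[R]_n) :
  semialgebraic A -> semialgebraic (~` A).
Proof.
have nonpos (p : poly_in R n) : semialgebraic [set x | ~~ (0 < peval p x)].
  rewrite (_ : [set _ | _] = [set x | peval p x = 0] `|` [set x | 0 < - peval p x]).
    apply: semialgebraicU; first exact/semialgebraic_zero/polyfun_peval.
    exact/semialgebraic_pos/polyfunN/polyfun_peval.
  apply/seteqP; split=> x /=; rewrite -leNgt oppr_gt0 le_eqVlt.
  + by move=> /orP[/eqP|]; [left|right].
  + by move=> [->|->]; rewrite ?eqxx ?orbT.
have nonzero (p : poly_in R n) : semialgebraic [set x | peval p x != 0].
  rewrite (_ : [set _ | _] = [set x | 0 < peval p x ^+ 2]).
    exact/semialgebraic_pos/polyfunX/polyfun_peval.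
  by apply/seteqP; split=> x /=; rewrite exprn_even_gt0.
have nonbasic (b : poly_in R n * seq (poly_in R n)) :
    semialgebraic [set x | ~~ basic_holds b x].
  case: b => p q; rewrite /basic_holds /=; elim: q => [|q qs ih].
    by under eq_set do rewrite /= andbT; exact: nonzero.
  under eq_set do rewrite /= andbCA negb_and.
  have := semialgebraicU (nonpos q) ih.
  by congr semialgebraic; apply/seteqP; split=> x /orP.
move=> /semialgebraicP[s As].
rewrite (_ : ~` A = [set x | ~~ has (fun b => basic_holds b x) s]); last first.
  by apply/seteqP; split=> x /=; [move=> nA; apply/negP => /As|
    move=> /negP nA /As].
elim: s {A As} => [|b s ih].
  by rewrite (_ : [set _ | _] = setT); [exact: semialgebraicT|by apply/seteqP; split].
under eq_set do rewrite /= negb_or.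
have := semialgebraicI (nonbasic b) ih.
by congr semialgebraic; apply/seteqP; split=> x /andP.
Qed.

Lemma semialgebraic_preimage n k (A : set 'rV[R]_k) (X : 'rV[R]_n -> 'rV[R]_k) :
  polymap X -> semialgebraic A -> semialgebraic [set x | A (X x)].
Proof.
move=> pX /semialgebraicP[s As].
rewrite (_ : [set _ | _] = [set x | has (fun b => basic_holds b (X x)) s]); last first.
  by apply/seteqP; split=> x /=; move=> /As.
elim: s {A As} => [|[p q] s ih].
  by rewrite (_ : [set _ | _] = set0); [exact: semialgebraic0|by apply/seteqP; split].
rewrite (_ : [set _ | _] = ([set x | peval p (X x) = 0] `&`
  [set x | all (fun q => 0 < peval q (X x)) q]) `|`
  [set x | has (fun b => basic_holds b (X x)) s]); last first.
  apply/seteqP; split=> x /=.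
  + by move=> /orP[/andP[/eqP]|]; [left|right].
  + by move=> [[/eqP p0 q0]|->]; rewrite /= ?orbT //; apply/orP; left; apply/andP.
apply: semialgebraicU => //; apply: semialgebraicI.
  by apply: semialgebraic_zero; apply: polyfun_comp => //; exact: polyfun_peval.
elim: q {s ih} => [|q qs ih].
  by rewrite (_ : [set _ | _] = setT); [exact: semialgebraicT|by apply/seteqP; split].
rewrite (_ : [set _ | _] = [set x | 0 < peval q (X x)] `&`
  [set x | all (fun q => 0 < peval q (X x)) qs]); last first.
  by apply/seteqP; split=> x /andP.
apply: semialgebraicI => //; apply: semialgebraic_pos; apply: polyfun_comp => //.
exact: polyfun_peval.
Qed.

Lemma semialgebraic_lt n (F G : 'rV[R]_n -> R) :
  polyfun F -> polyfun G -> semialgebraic [set x | F x < G x].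
Proof.
move=> pF pG; have := semialgebraic_pos (polyfunB pG pF).
by congr semialgebraic; apply/seteqP; split=> x /=; rewrite subr_gt0.
Qed.

Lemma semialgebraic_le n (F G : 'rV[R]_n -> R) :
  polyfun F -> polyfun G -> semialgebraic [set x | F x <= G x].
Proof.
move=> pF pG; have := semialgebraicC (semialgebraic_lt pG pF).
by congr semialgebraic; apply/seteqP; split=> x /=; rewrite leNgt => /negP.
Qed.

Lemma semialgebraic_eq n (F G : 'rV[R]_n -> R) :
  polyfun F -> polyfun G -> semialgebraic [set x | F x = G x].
Proof.
move=> pF pG; have := semialgebraic_zero (polyfunB pF pG).
by congr semialgebraic; apply/seteqP; split=> x /=; [move/subr0_eq|move=> ->; rewrite subrr].
Qed.

Lemma semialgebraic_forall n k (A : 'I_k -> set 'rV[R]_n) :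
  (forall i, semialgebraic (A i)) -> semialgebraic [set x | forall i, A i x].
Proof.
move=> sA; suff : semialgebraic [set x | forall i, i \in enum 'I_k -> A i x].
  congr semialgebraic; apply/seteqP; split=> x Ax i; last by move=> _; exact: Ax.
  by apply: Ax; rewrite mem_enum.
elim: (enum 'I_k) => [|i s ih].
  by rewrite (_ : [set _ | _] = setT); [exact: semialgebraicT|by apply/seteqP; split].
have := semialgebraicI (sA i) ih; congr semialgebraic; apply/seteqP; split=> x.
  by move=> [Aix Ax] j; rewrite inE => /orP[/eqP ->|/Ax].
by move=> Ax; split=> [|j js]; apply: Ax; rewrite inE ?eqxx // js orbT.
Qed.

Lemma semialgebraic_exists n k (A : 'I_k -> set 'rV[R]_n) :
  (forall i, semialgebraic (A i)) -> semialgebraic [set x | exists i, A i x].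
Proof.
move=> sA.
have := semialgebraicC (semialgebraic_forall (fun i => semialgebraicC (sA i))).
congr semialgebraic; apply/seteqP; split=> x /=.
  by move=> /existsNP[i /contrapT]; exists i.
by move=> [i Ai] /(_ i).
Qed.

End SemialgebraicSets.

(** * Projections of semialgebraic sets *)

Section Projection.
Context {R : realType}.
Local Notation formula := (ordered_qelim.ord.formula R).
Local Notation rformula := (@ordered_qelim.ord.rformula R).
Local Notation holds := (@ordered_qelim.ord.holds R).

(** Formulas are evaluated in sequences of reals; [row_of] and [seq_of] translate between such
    environments and points. *)
Definition row_of n (e : seq R) : 'rV[R]_n := \row_i e`_i.

Definition seq_of n (x : 'rV[R]_n) : seq R := [seq x ord0 i | i <- enum 'I_n].

Lemma nth_seq_of n (x : 'rV[R]_n) (i : 'I_n) : (seq_of x)`_i = x ord0 i.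
Proof. by rewrite (nth_map i) ?size_enum_ord // nth_ord_enum. Qed.

Lemma term_of_polyfun n (F : 'rV[R]_n -> R) : polyfun F ->
  exists2 t : GRing.term R, GRing.rterm t & forall e, GRing.eval e t = F (row_of n e).
Proof.
move: F; apply: polyfun_ind => [c|i|F G [t rt tE] [u ru uE]|F G [t rt tE] [u ru uE]].
- by exists (GRing.Const c).
- by exists (GRing.Var R i) => // e; rewrite mxE.
- by exists (GRing.Add t u) => /= [|e]; rewrite ?rt ?tE ?uE.
- by exists (GRing.Mul t u) => /= [|e]; rewrite ?rt ?tE ?uE.
Qed.

Lemma polyfun_of_term n (t : GRing.term R) :
  GRing.rterm t -> @polyfun R n (fun x => GRing.eval (seq_of x) t).
Proof.
elim: t => //=.
- move=> i _; case: (ltnP i n) => [lt_in|le_ni].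
  + apply: eq_polyfun (polyfun_coord (Ordinal lt_in)) _ => x.
    by rewrite -nth_seq_of.
  (* A variable beyond the coordinates of [x] reads the default value 0. *)
  + apply: eq_polyfun (polyfun_cst _ 0) _ => x.
    by rewrite nth_default // size_map size_enum_ord.
- by move=> c _; exact: polyfun_cst.
- by move=> k _; exact: polyfun_cst.
- by move=> t iht u ihu /andP[/iht pt /ihu pu]; exact: polyfunD.
- by move=> t iht /iht; exact: polyfunN.
- move=> t iht k /iht pt; apply: eq_polyfun (polyfunM pt (polyfun_cst _ k%:R)) _ => x.
  by rewrite mulr_natr.
- by move=> t iht u ihu /andP[/iht pt /ihu pu]; exact: polyfunM.
- by move=> t iht k /iht; exact: polyfunX.
Qed.

Lemma formula_of_semialgebraic n (A : set 'rV[R]_n) : semialgebraic A ->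
  exists2 f : formula, rformula f & forall e, holds e f <-> A (row_of n e).
Proof.
move=> /semialgebraicP[s As].
suff [f rf fE] : exists2 f : formula, rformula f &
    forall e, holds e f <-> has (fun b => basic_holds b (row_of n e)) s.
  by exists f => // e; rewrite fE As.
elim: s {A As} => [|[p q] s [f rf fE]].
  by exists (ordered_qelim.ord.Bool false).
have [t rt tE] := term_of_polyfun (polyfun_peval p).
suff [g rg gE] : exists2 g : formula, rformula g &
    forall e, holds e g <-> all (fun q => 0 < peval q (row_of n e)) q.
  exists (ordered_qelim.ord.Or (ordered_qelim.ord.And
    (ordered_qelim.ord.Equal t (GRing.NatConst R 0)) g) f) => /=.
    by rewrite rt rg rf.
  move=> e; rewrite fE gE tE /basic_holds /=; split.
  - by move=> [[-> ->]|->]; rewrite ?eqxx ?orbT.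
  - by move=> /orP[/andP[/eqP -> ->]|->]; [left|right].
elim: q {s f rf fE} => [|q qs [g rg gE]].
  by exists (ordered_qelim.ord.Bool true).
have [u ru uE] := term_of_polyfun (polyfun_peval q).
exists (ordered_qelim.ord.And (ordered_qelim.ord.Lt (GRing.NatConst R 0) u) g) => /=.
  by rewrite ru rg.
by move=> e; rewrite gE uE; split=> [[-> ->]|/andP[-> ->]].
Qed.

Lemma semialgebraic_of_qf n (f : formula) :
  ordered_qelim.ord.qf_form f -> rformula f ->
  semialgebraic [set x : 'rV[R]_n | ordered_qelim.ord.qf_eval (seq_of x) f].
Proof.
elim: f => //=.
- case=> _ _.
  + by rewrite (_ : [set _ | _] = setT); [exact: semialgebraicT|by apply/seteqP; split].
  + by rewrite (_ : [set _ | _] = set0); [exact: semialgebraic0|by apply/seteqP; split].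
- move=> t u _ /andP[/(@polyfun_of_term n) pt /(@polyfun_of_term n) pu].
  have := semialgebraic_eq pt pu.
  by congr semialgebraic; apply/seteqP; split=> x /= /eqP.
- move=> t u _ /andP[/(@polyfun_of_term n) pt /(@polyfun_of_term n)].
  exact: semialgebraic_lt.
- move=> t u _ /andP[/(@polyfun_of_term n) pt /(@polyfun_of_term n)].
  exact: semialgebraic_le.
- move=> f ihf g ihg /andP[qf qg] /andP[rf rg].
  have := semialgebraicI (ihf qf rf) (ihg qg rg).
  by congr semialgebraic; apply/seteqP; split=> x /andP.
- move=> f ihf g ihg /andP[qf qg] /andP[rf rg].
  have := semialgebraicU (ihf qf rf) (ihg qg rg).
  by congr semialgebraic; apply/seteqP; split=> x /orP.
- move=> f ihf g ihg /andP[qf qg] /andP[rf rg].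
  have := semialgebraicU (semialgebraicC (ihf qf rf)) (ihg qg rg).
  congr semialgebraic; apply/seteqP; split=> x /=.
    by move=> [/negP/negbTE ->|->] //; exact: implybT.
  by case: ordered_qelim.ord.qf_eval => /= [->|_]; [right|left].
- move=> f ihf qf rf; have := semialgebraicC (ihf qf rf).
  by congr semialgebraic; apply/seteqP; split=> x /negP.
Qed.

(** Tarski-Seidenberg: the last coordinate is the variable of index [n], and quantifier elimination
    over the real closed field [R] removes its quantifier. *)
Lemma semialgebraic_proj1 n (A : set 'rV[R]_(n + 1)) :
  semialgebraic A -> semialgebraic [set x | exists y, A (row_mx x y)].
Proof.
move=> /formula_of_semialgebraic[f rf fE].
pose ef := ordered_qelim.ord.Exists n f.
have ref : rformula ef by [].
have qE e := ordered_qelim.ord.quantifier_elim_rformP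
  (@qe_rcf.wf_QE_wproj R) (@qe_rcf.valid_QE_wproj R) e ref.
have /andP[qf rq] := ordered_qelim.ord.quantifier_elim_wf (@qe_rcf.wf_QE_wproj R) ref.
have := semialgebraic_of_qf n qf rq; congr semialgebraic.
have rowE (x : 'rV[R]_n) t :
    row_of (n + 1) (set_nth 0 (seq_of x) n t) = row_mx x (\row__ t).
  apply/rowP => i; rewrite mxE nth_set_nth /=; case: (split_ordP i) => j ->.
  - by rewrite row_mxEl /= ltn_eqF // nth_seq_of.
  - by rewrite row_mxEr mxE /= ord1 addn0 eqxx.
apply/seteqP; split=> x.
- by move=> /qE /= [t /fE]; rewrite rowE; exists (\row__ t).
- move=> [y Axy]; apply/qE; exists (y ord0 ord0); apply/fE; rewrite rowE.
  by congr (A (row_mx _ _)): Axy; apply/rowP => i; rewrite mxE ord1.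
Qed.

Lemma semialgebraic_proj n m (A : set 'rV[R]_(n + m)) :
  semialgebraic A -> semialgebraic [set x | exists y, A (row_mx x y)].
Proof.
elim: m A => [|m ih] A sA.
  have pX : polymap (fun x : 'rV[R]_n => row_mx x (0 : 'rV[R]_0)).
    by apply: polymap_row_mx; [exact: polymap_id|exact: polymap_cst].
  have := semialgebraic_preimage pX sA; congr semialgebraic.
  apply/seteqP; split=> x; first by exists 0.
  by move=> [y]; rewrite [y](_ : _ = 0) //; apply/rowP => -[].
(* [X] regroups ((x, y), t) as (x, (y, t)), so that [t] is eliminated first and [y] by induction. *)
pose X (z : 'rV[R]_(n + m + 1)) : 'rV[R]_(n + m.+1) :=
  row_mx (lsubmx (lsubmx z))
    (castmx (erefl, addn1 m) (row_mx (rsubmx (lsubmx z)) (rsubmx z))).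
have pX : polymap X.
  apply: polymap_row_mx.
    by apply: polymap_lsubmx; apply: polymap_lsubmx; exact: polymap_id.
  move=> i; have pY : polymap (fun z : 'rV[R]_(n + m + 1) =>
      row_mx (rsubmx (lsubmx z)) (rsubmx z)).
    apply: polymap_row_mx; last by apply: polymap_rsubmx; exact: polymap_id.
    by apply: polymap_rsubmx; apply: polymap_lsubmx; exact: polymap_id.
  apply: eq_polyfun (pY (cast_ord (esym (addn1 m)) i)) _ => z.
  by rewrite castmxE /= cast_ord_id.
have := ih _ (semialgebraic_proj1 (semialgebraic_preimage pX sA)).
congr semialgebraic; apply/seteqP; split=> x /=.
- move=> [y [t Az]]; exists (castmx (erefl, addn1 m) (row_mx y t)).
  by move: Az; rewrite /X /= !row_mxKl !row_mxKr.
- move=> [y Axy]; pose w := castmx (erefl 1%N, esym (addn1 m)) y.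
  exists (lsubmx w), (rsubmx w); rewrite /X /= !row_mxKl !row_mxKr hsubmxK.
  by rewrite castmx_comp /= castmx_id.
Qed.

End Projection.

(** * Growth of semialgebraic sets of the plane *)

Section Growth.
Context {R : realType}.

Lemma poly_sign_pinfty (p : {poly R}) : p != 0 ->
  exists r0 d s : R, [/\ 1 <= r0, 0 < d &
    forall r, r0 <= r -> d <= `|p.[r]| /\ Num.sg p.[r] = s].
Proof.
elim/poly_ind: p => [|p c ih]; first by rewrite eqxx.
have [->|p0 _] := eqVneq p 0.
  rewrite mul0r add0r polyC_eq0 => c0.
  by exists 1, `|c|, (Num.sg c); split=> [||r _]; rewrite ?normr_gt0 // hornerC.
have [r0 [d [s [r1 d0 H]]]] := ih p0.
(* Beyond this threshold |p(r) r| >= d r >= |c| + d, so adding [c] changes neither the sign nor the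
   lower bound [d]. *)
exists (r0 + (`|c| + d) / d), d, s.
have M0 : 0 <= (`|c| + d) / d by rewrite divr_ge0 ?addr_ge0 // ltW.
split=> // [|r rM]; first exact: ler_wpDr.
have r0r : r0 <= r by rewrite (le_trans _ rM) // lerDl.
have Mr : (`|c| + d) / d <= r.
  by apply: le_trans rM; rewrite lerDr (le_trans _ r1).
have rgt0 : 0 < r by rewrite (lt_le_trans ltr01) // (le_trans r1).
have [dp sp] := H r r0r.
have big : `|c| + d <= `|p.[r] * r|.
  rewrite normrM (gtr0_norm rgt0).
  apply: le_trans (ler_wpM2r (ltW rgt0) dp).
  by move: Mr; rewrite ler_pdivrMr // mulrC.
rewrite !hornerE; split.
  by have := lerB_normD (p.[r] * r) c; lra.
have: Num.sg (p.[r] * r) = s by rewrite sgrM sp (gtr0_sg rgt0) mulr1.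
move: (p.[r] * r) big => u big <-.
have := ler_norm c; have := ler_norm (- c); rewrite normrN => c1 c2.
have := normr_ge0 c => c3.
case: (ltrgtP u 0) big => [u0|u0|->]; last by rewrite normr0; lra.
- rewrite (ltr0_norm u0) => big; rewrite (ltr0_sg u0) ltr0_sg //; lra.
- rewrite (gtr0_norm u0) => big; rewrite (gtr0_sg u0) gtr0_sg //; lra.
Qed.

(** The outer indeterminate of [q] stands for [s], and its coefficients are polynomials in [r]. The
    growth in [r] is polynomial, uniformly for [s] in [0, 1]. *)
Lemma poly2_bound (q : {poly {poly R}}) : exists C N, 0 < C /\
  forall r s : R, 1 <= r -> 0 <= s <= 1 -> `|q.[s%:P].[r]| <= C * r ^+ N.
Proof.
have bound1 (p : {poly R}) : exists C N, 0 < C /\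
    forall r : R, 1 <= r -> `|p.[r]| <= C * r ^+ N.
  elim/poly_ind: p => [|p c [C [N [C0 H]]]].
    by exists 1, 0%N; split=> // r _; rewrite horner0 normr0 mulr1.
  exists (C + `|c|), N.+1; split=> [|r r1]; first exact: ltr_wpDr.
  rewrite !hornerE (le_trans (ler_normD _ _)) // mulrDl lerD //.
    have r0 : 0 <= r := le_trans ler01 r1.
    by rewrite normrM exprSr mulrA (ger0_norm r0) ler_wpM2r ?H.
  by rewrite ler_peMr // exprn_ege1.
elim/poly_ind: q => [|q c [C [N [C0 H]]]].
  by exists 1, 0%N; split=> // r s _ _; rewrite !horner0 normr0 mulr1.
have [D [M [D0 H']]] := bound1 c.
exists (C + D), (maxn N M); split=> [|r s r1 /andP[s0 s1]]; first exact: addr_gt0.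
rewrite !hornerE (le_trans (ler_normD _ _)) // mulrDl lerD //.
  rewrite normrM (ger0_norm s0) -[leRHS]mulr1 ler_pM ?H ?s0 //.
  rewrite (le_trans (H _ _ r1 _)) ?s0 // ler_pM2l //.
  by rewrite ler_weXn2l // leq_maxl.
by rewrite (le_trans (H' _ r1)) // ler_pM2l // ler_weXn2l // leq_maxr.
Qed.

(* The sign of q(r, s) in a region 0 < s < c r^-N is that of its lowest nonzero
   coefficient in s. *)
Lemma poly2_sign_region (q : {poly {poly R}}) : exists (r0 c sg : R) (N : nat),
  [/\ 1 <= r0, 0 < c & forall r s, r0 <= r -> 0 < s -> s * r ^+ N < c ->
    Num.sg q.[s%:P].[r] = sg].
Proof.
elim/poly_ind: q => [|q a [r0 [c [sg [N [r1 c0 H]]]]]].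
  by exists 1, 1, 0, 0%N; split=> // r s _ _ _; rewrite !horner0 sgr0.
(* Without a constant term in [s], the factor [s > 0] leaves the sign of [q] unchanged. *)
have [->|a0] := eqVneq a 0.
  exists r0, c, sg, N; split=> // r s r0r s0 src.
  by rewrite addr0 !hornerE sgrM H // (gtr0_sg s0) mulr1.
have [r2 [d [sg' [r21 d0 H2]]]] := poly_sign_pinfty a0.
have [C [M [C0 H3]]] := poly2_bound q.
(* In this region [s <= 1], so the bound on [q] applies and |q(r, s) s| <= C r^M s < d <= |a(r)|:
   the constant term [a] decides the sign. *)
exists r2, (Num.min 1 (d / C)), sg', M; split=> //.
  by rewrite lt_min ltr01 divr_gt0.
move=> r s r2r s0; rewrite lt_min => /andP[s1 sC].
have r1' : 1 <= r := le_trans r21 r2r.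
have rM1 : 1 <= r ^+ M by rewrite exprn_ege1.
have {}s1 : s <= 1 by rewrite (le_trans _ (ltW s1)) // ler_peMr // ltW.
have [da <-] := H2 r r2r.
have : `|q.[s%:P].[r] * s| < d.
  rewrite normrM (gtr0_norm s0).
  rewrite (le_lt_trans (ler_wpM2r (ltW s0) (H3 r s r1' _))) ?s1 ?(ltW s0) //.
  by rewrite -mulrA mulrC [_ * s]mulrC -ltr_pdivlMr.
rewrite !hornerE; move: (q.[_].[r] * s) => u /ltr_normlP[u1 u2].
case: (ltrgtP a.[r] 0) da => [h|h|->]; last by rewrite normr0; lra.
- rewrite (ltr0_norm h) => big; rewrite (ltr0_sg h) ltr0_sg //; lra.
- rewrite (gtr0_norm h) => big; rewrite (gtr0_sg h) gtr0_sg //; lra.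
Qed.

Definition pair_row (r s : R) : 'rV[R]_(1 + 1) := row_mx (\row__ r) (\row__ s).

Lemma polyfun_poly2 (F : 'rV[R]_(1 + 1) -> R) : polyfun F ->
  exists q : {poly {poly R}}, forall r s, F (pair_row r s) = q.[s%:P].[r].
Proof.
move: F; apply: polyfun_ind => [c|i|F G [p pE] [q qE]|F G [p pE] [q qE]].
- by exists c%:P%:P => r s; rewrite !hornerE.
- case: (split_ordP i) => j ->.
  + by exists 'X%:P => r s; rewrite row_mxEl mxE !hornerE.
  + by exists 'X => r s; rewrite row_mxEr mxE !hornerE.
- by exists (p + q) => r s; rewrite pE qE !hornerE.
- by exists (p * q) => r s; rewrite pE qE !hornerE.
Qed.

(** For large [r], the truth of [b] at (r, s) is the same for all [s] in the thin region 0 < s < c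
    r^-N. *)
Definition region_constant (b : 'rV[R]_(1 + 1) -> bool) :=
  exists (r0 c : R) (N : nat), [/\ 1 <= r0, 0 < c &
    forall r s s', r0 <= r -> 0 < s -> s * r ^+ N < c -> 0 < s' -> s' * r ^+ N < c ->
    b (pair_row r s) = b (pair_row r s')].

Lemma region_constant_op (op : bool -> bool -> bool) b b' :
  region_constant b -> region_constant b' ->
  region_constant (fun z => op (b z) (b' z)).
Proof.
move=> [r0 [c [N [r1 c0 H]]]] [r0' [c' [N' [r1' c0' H']]]].
exists (Num.max r0 r0'), (Num.min c c'), (maxn N N'); split.
- by rewrite le_max r1.
- by rewrite lt_min c0.
- move=> r s s'; rewrite ge_max => /andP[r0r r0'r] s0 + s0' +.
  have r1r := le_trans r1 r0r.
  have mono t : 0 < t -> t * r ^+ maxn N N' < Num.min c c' ->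
      t * r ^+ N < c /\ t * r ^+ N' < c'.
    move=> t0; rewrite lt_min => /andP[h1 h2].
    split; [apply: le_lt_trans h1|apply: le_lt_trans h2].
    + by rewrite ler_pM2l // ler_weXn2l // leq_maxl.
    + by rewrite ler_pM2l // ler_weXn2l // leq_maxr.
  move=> /(mono _ s0)[a1 a2] /(mono _ s0')[b1 b2].
  by rewrite (H r s s') // (H' r s s').
Qed.

(** The tests [p = 0] and [0 < p] depend only on the sign of [p], which does not vary with [s] in a
    thin region. *)
Lemma region_constant_sign (f : R -> bool) (p : poly_in R (1 + 1)) :
  (forall u, f (Num.sg u) = f u) -> region_constant (fun z => f (peval p z)).
Proof.
move=> fsg; have [q qE] := polyfun_poly2 (polyfun_peval p).
have [r0 [c [sg [N [r1 c0 H]]]]] := poly2_sign_region q.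
exists r0, c, N; split=> // r s s' r0r s0 sc s'0 s'c.
by rewrite -[LHS]fsg -[RHS]fsg !qE !H.
Qed.

Lemma region_constant_has (s : seq (poly_in R (1 + 1) * seq (poly_in R (1 + 1)))) :
  region_constant (fun z => has (fun b => basic_holds b z) s).
Proof.
have cst b : region_constant (fun=> b) by exists 1, 1, 0%N.
elim: s => [|[p q] s ih]; first exact: cst.
apply: (region_constant_op orb) ih; apply: (region_constant_op andb).
  by apply: (@region_constant_sign (fun u => u == 0)) => u; rewrite sgr_eq0.
elim: q {s} => [|q qs ih]; first exact: cst.
apply: (region_constant_op andb) ih.
by apply: (@region_constant_sign (fun u => 0 < u)) => u; rewrite sgr_gt0.
Qed.

(* For r large and 0 < s < c r^-N, membership of (r, s) in E does not depend on
   s, so a point of E there would put points arbitrarily close to 0 in its fibre. *)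
Lemma semialgebraic_fibre_bound (E : set 'rV[R]_(1 + 1)) : semialgebraic E ->
  (forall r, exists2 e : R, 0 < e & forall s, E (pair_row r s) -> e <= s) ->
  exists (r0 c : R) (N : nat), [/\ 1 <= r0, 0 < c &
    forall r s, r0 <= r -> E (pair_row r s) -> c <= s * r ^+ N].
Proof.
move=> /semialgebraicP[b bE] E0; have [r0 [c [N [r1 c0 H]]]] := region_constant_has b.
exists r0, c, N; split=> // r s r0r Es; rewrite leNgt; apply/negP => sc.
have [e e0 eE] := E0 r; have es := eE _ Es; have s0 := lt_le_trans e0 es.
have e2 : e / 2 < e by rewrite ltr_pdivrMr // ltr_pMr // ltr1n.
suff /eE : E (pair_row r (e / 2)) by rewrite leNgt e2.
have rN : 0 <= r ^+ N by rewrite exprn_ge0 // (le_trans _ r0r) // (le_trans _ r1).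
apply/bE; rewrite (H r _ s) ?divr_gt0 //; first exact/bE.
by apply: le_lt_trans sc; rewrite ler_wpM2r // (le_trans (ltW e2)).
Qed.

End Growth.

(** * The finiteness theorem *)

Section Finiteness.
Context {R : realType}.
Implicit Types n k : nat.

Lemma closed_polyfun_le n (F G : 'rV[R]_n -> R) :
  polyfun F -> polyfun G -> closed [set x | F x <= G x].
Proof.
move=> pF pG; rewrite (_ : [set _ | _] = (fun x => G x - F x) @^-1` [set y | 0 <= y]).
  apply: closed_comp; last exact: closed_ge.
  by move=> x _; apply: (polyfun_continuous (polyfunB pG pF)).
by apply/seteqP; split=> x /=; rewrite subr_ge0.
Qed.

Lemma compact_box n (a b : 'I_n -> R) :
  compact [set x : 'rV[R]_n | forall i, a i <= x ord0 i <= b i].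
Proof.
have := @rV_compact R n (fun i => `[a i, b i]%classic)
  (fun i => @segment_compact R (a i) (b i)).
congr compact; apply/seteqP; split=> x H i; have := H i; by rewrite /= in_itv.
Qed.

(** A polynomial substitute for the norm; the added 1 makes it dominate every coordinate, as |t| <=
    1 + t^2. *)
Definition sqnorm1 n (x : 'rV[R]_n) := 1 + \sum_i x ord0 i ^+ 2.

Lemma polyfun_sqnorm1 n : polyfun (@sqnorm1 n).
Proof.
apply: polyfunD; first exact: polyfun_cst.
by apply: polyfun_sum => i; apply: polyfunX; exact: polyfun_coord.
Qed.

Lemma sqnorm1_ge1 n (x : 'rV[R]_n) : 1 <= sqnorm1 x.
Proof. by rewrite lerDl sumr_ge0 // => i _; exact: sqr_ge0. Qed.

Lemma sqnorm1_coord n (x : 'rV[R]_n) i : - sqnorm1 x <= x ord0 i <= sqnorm1 x.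
Proof.
have : 1 + x ord0 i ^+ 2 <= sqnorm1 x.
  by rewrite lerD2l (bigD1 i) //= lerDl sumr_ge0 // => j _; exact: sqr_ge0.
by move=> H; apply/andP; split; nra.
Qed.

(* The points of F with 1 + |x|^2 <= r and 1/r <= g x form a compact set, on
   which p ^ 2 is bounded below by some c r^-N; then r is chosen in terms of x. *)
Lemma lojasiewicz n (F : set 'rV[R]_n) (p g : 'rV[R]_n -> R) :
  closed F -> semialgebraic F -> polyfun p -> polyfun g ->
  (forall x, F x -> p x = 0 -> g x <= 0) ->
  exists (N : nat) (h : 'rV[R]_n -> R), polyfun h /\
    forall x, F x -> 0 < g x -> g x ^+ N <= h x * p x ^+ 2.
Proof.
move=> clF sF pp pg F0.
pose Z (w : 'rV[R]_(1 + 1 + n)) i := lsubmx w ord0 i.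
have pZ i : polyfun (Z ^~ i).
  by have := polymap_lsubmx (@polymap_id R (1 + 1 + n)); exact.
have pr : polymap (fun w : 'rV[R]_(1 + 1 + n) => rsubmx w).
  exact/polymap_rsubmx/polymap_id.
pose r_ w := Z w (lshift 1 ord0); pose s_ w := Z w (rshift 1 ord0).
(* Points ((r, s), x) with x in the compact set attached to [r] and s = p(x)^2; the projection to
   (r, s) is the planar set whose growth is bounded. *)
pose A := [set w | F (rsubmx w)] `&` [set w | sqnorm1 (rsubmx w) <= r_ w] `&`
  [set w | 1 <= r_ w * g (rsubmx w)] `&` [set w | s_ w = p (rsubmx w) ^+ 2].
have sA : semialgebraic A.
  apply: semialgebraicI; first apply: semialgebraicI; first apply: semialgebraicI.
  - exact: semialgebraic_preimage.
  - apply: semialgebraic_le (pZ _); exact: polyfun_comp (polyfun_sqnorm1 _) pr.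
  - apply: semialgebraic_le; first exact: polyfun_cst.
    by apply: polyfunM; [exact: pZ|exact: polyfun_comp pg pr].
  - apply: semialgebraic_eq; first exact: pZ.
    by apply: polyfunX; exact: polyfun_comp pp pr.
have AE r s x : A (row_mx (pair_row r s) x) <->
    [/\ F x, sqnorm1 x <= r, 1 <= r * g x & s = p x ^+ 2].
  rewrite /A /r_ /s_ /Z /= !row_mxKr !row_mxKl /pair_row row_mxEl row_mxEr !mxE.
  by split=> [[[[? ?] ?] ?]|[? ? ? ?]].
have [|r0 [c [N [r1 c0 H]]]] := semialgebraic_fibre_bound (semialgebraic_proj sA).
  move=> r; pose K := F `&` [set x | sqnorm1 x <= r] `&` [set x | 1 <= r * g x].
  have clK : closed K.
    apply: closedI; first apply: closedI => //.
      by apply: closed_polyfun_le; [exact: polyfun_sqnorm1|exact: polyfun_cst].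
    apply: closed_polyfun_le; first exact: polyfun_cst.
    by apply: polyfunM => //; exact: polyfun_cst.
  have cK : compact K.
    apply: (subclosed_compact clK (@compact_box n (fun _ => - r) (fun _ => r))).
    move=> x [[_ /= xr] _] i; have /andP[h1 h2] := sqnorm1_coord x i.
    by rewrite (le_trans _ h1) ?lerN2 // (le_trans h2).
  have [K0|/nonemptyPn K0] := pselect (K !=set0); last first.
    exists 1 => // s [x /AE[Fx xr gx _]].
    by suff : K x by rewrite K0.
  have pp2 : polyfun (fun x => p x ^+ 2) by exact: polyfunX.
  have [|y /set_mem[[Fy /= yr] gy] ymin] := @EVT_min_rV R n (fun x => p x ^+ 2) K K0 cK.
    exact/continuous_subspaceT/polyfun_continuous.
  have r0 : 0 < r by rewrite (lt_le_trans ltr01) // (le_trans (sqnorm1_ge1 y)).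
  (* The minimum is positive: [p y = 0] would give [g y <= 0], against [1 <= r * g y]. *)
  exists (p y ^+ 2).
    rewrite exprn_even_gt0 //; apply/eqP => /(F0 _ Fy) gy0.
    by move: gy; rewrite /= leNgt => /negP; apply; rewrite (le_lt_trans _ ltr01) // pmulr_rle0.
  move=> s [x /AE[Fx xr gx ->]]; apply: ymin; exact/mem_set.
have pr0 := polyfunD (polyfun_cst _ r0) (@polyfun_sqnorm1 n).
(* For r = r0 + sqnorm1 x + 1 / g x one has c <= p^2 r^N. Multiplying by g^N replaces r by r g = (r0
   + sqnorm1 x) g + 1, which is polynomial. *)
exists N, (fun x => c^-1 * ((r0 + sqnorm1 x) * g x + 1) ^+ N); split.
  apply: polyfunM; first exact: polyfun_cst.
  by apply: polyfunX; apply: polyfunD; [exact: polyfunM|exact: polyfun_cst].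
move=> x Fx gx; pose r := r0 + sqnorm1 x + (g x)^-1.
have rg : r * g x = (r0 + sqnorm1 x) * g x + 1 by rewrite mulrDl mulVf // gt_eqF.
have gi : 0 < (g x)^-1 by rewrite invr_gt0.
have nx := sqnorm1_ge1 x.
have : c <= p x ^+ 2 * r ^+ N.
  apply: H; first by rewrite /r; lra.
  exists x; apply/AE; split=> //; first by rewrite /r; lra.
  by rewrite rg lerDr mulr_ge0 ?(ltW gx) //; lra.
rewrite -rg exprMn => cp; rewrite -mulrA ler_pdivlMl //.
rewrite [leRHS](_ : _ = p x ^+ 2 * r ^+ N * g x ^+ N); last by ring.
by rewrite ler_wpM2r // exprn_ge0 // ltW.
Qed.

Lemma prodr_gt0_all (I : Type) (r : seq I) (F : I -> R) :
  all (fun i => 0 <= F i) r -> (0 < \prod_(i <- r) F i) = all (fun i => 0 < F i) r.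
Proof.
elim: r => [|i r ih] /=; first by rewrite big_nil ltr01.
rewrite big_cons le_eqVlt => /andP[/orP[/eqP <-|Fi] /ih <-]; first by rewrite mul0r ltxx.
by rewrite pmulr_rgt0 // Fi.
Qed.

(* A basic piece {p = 0, q_j > 0} of A is thickened to {h p^2 < g^N, q_j > 0}, where
   g is the product of the q_j; the Lojasiewicz inequality on the points outside A
   with all q_j >= 0 keeps the thickened set inside A. *)
Lemma open_semialgebraic n (A : set 'rV[R]_n) : semialgebraic A -> open A ->
  exists s : seq (seq (poly_in R n)),
    forall x, A x <-> has (fun qs => all (fun q => 0 < peval q x) qs) s.
Proof.
move=> sA oA; have /semialgebraicP[s As] := sA.
have : forall x, has (fun b => basic_holds b x) s -> A x by move=> x /As.
(* The pieces are thickened one at a time inside the fixed set [A]: the new list must cover the old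
   pieces without leaving [A]. *)
suff H : (forall x, has (fun b => basic_holds b x) s -> A x) ->
  exists t : seq (seq (poly_in R n)),
    (forall x, has (fun qs => all (fun q => 0 < peval q x) qs) t -> A x) /\
    (forall x, has (fun b => basic_holds b x) s ->
      has (fun qs => all (fun q => 0 < peval q x) qs) t).
  by move=> /H[t [tA st]]; exists t => x; split=> [/As /st|/tA].
elim: s {As} => [|[p qs] s ih] sub; first by exists [::].
have [x sx|t [tA st]] := ih; first by apply: sub; rewrite /= sx orbT.
pose g x := \prod_(q <- qs) peval q x.
have pg : polyfun g by apply: polyfun_prod => q; exact: polyfun_peval.
pose F := ~` A `&` [set x | all (fun q => 0 <= peval q x) qs].
have [clF sF] : closed F /\ semialgebraic F.
  suff [clQ sQ] : closed [set x | all (fun q => 0 <= peval q x) qs] /\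
      semialgebraic [set x | all (fun q => 0 <= peval q x) qs].
    split; first by apply: closedI => //; rewrite closedC.
    by apply: semialgebraicI => //; exact: semialgebraicC.
  elim: qs {sub g pg F} => [|q qs [clQ sQ]].
    rewrite (_ : [set _ | _] = setT); last by apply/seteqP; split.
    by split; [exact: closedT|exact: semialgebraicT].
  rewrite (_ : [set _ | _] = [set x | 0 <= peval q x] `&`
    [set x | all (fun q => 0 <= peval q x) qs]); last first.
    by apply/seteqP; split=> x /andP.
  split; [apply: closedI|apply: semialgebraicI] => //.
  + by apply: closed_polyfun_le; [exact: polyfun_cst|exact: polyfun_peval].
  + by apply: semialgebraic_le; [exact: polyfun_cst|exact: polyfun_peval].
(* If [p = 0] and [g > 0] at a point where all [q >= 0], then all [q > 0], and the point lies in the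
   basic piece, hence in [A]. *)
have [x [nAx /= q0] p0|N [h [ph H]]] := lojasiewicz clF sF (polyfun_peval p) pg.
  rewrite leNgt; apply/negP => gx; apply: nAx; apply: sub.
  rewrite /= /basic_holds /= p0 eqxx /=; apply/orP; left.
  by rewrite -(prodr_gt0_all q0).
have qs_ge0 x : all (fun q => 0 < peval q x) qs -> all (fun q => 0 <= peval q x) qs.
  by apply: sub_all => q /ltW.
have g_gt0 x : all (fun q => 0 < peval q x) qs -> 0 < g x.
  by move=> qx; rewrite /g prodr_gt0_all //; exact: qs_ge0.
have [u uE] : polyfun (fun x => g x ^+ N - h x * peval p x ^+ 2).
  by apply: polyfunB; [exact: polyfunX|apply: polyfunM => //; exact/polyfunX/polyfun_peval].
exists ((u :: qs) :: t); split=> x /=.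
  move=> /orP[/andP[ux qx]|/tA //]; apply: contrapT => nAx.
  have /H /(_ (g_gt0 _ qx)) : F x by split=> //; exact: qs_ge0.
  by move: ux; rewrite uE subr_gt0 ltNge => /negP.
(* On the original piece [p = 0], so [u] reduces to g^N > 0. *)
move=> /orP[/andP[/eqP /= p0 qx]|/st ->]; last exact: orbT.
apply/orP; left; rewrite qx uE p0 expr0n mulr0 subr0 andbT exprn_gt0 //.
exact: g_gt0.
Qed.

End Finiteness.

(** * Realizing piecewise polynomial functions *)

Section Realizable.
Context {R : realType} {n : nat}.
Implicit Types (D : set 'rV[R]_n) (V W : 'rV[R]_n -> set R).

(** The whole set of upper-level values is recorded, not only its infimum, so that problems can be
    combined before the infimum is taken. *)
Definition realizable V :=
  exists (m : nat) (P Q : poly_in R (n + m)) (Y : set 'rV[R]_m),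
    [/\ forall x, convex_function [set: 'rV[R]_m] (peval2 Q x),
        bounded_box Y
      & forall x, V x = [set peval2 P x y | y in lower_argmin Q Y x]].

(** This says that [phi] is polynomial in all its arguments, in the form of stability under
    polynomial substitution. *)
Definition polyop (phi : 'rV[R]_n -> R -> R -> R) :=
  forall k (X : 'rV[R]_k -> 'rV[R]_n) (U W : 'rV[R]_k -> R),
    polymap X -> polyfun U -> polyfun W -> polyfun (fun z => phi (X z) (U z) (W z)).

(** The two lower levels act on separate blocks of variables and their objectives are added: the sum
    stays convex, its argmin is the product of the two argmins, and [u] and [v] vary
    independently. *)
Lemma realizable2 (phi : 'rV[R]_n -> R -> R -> R) V W :
  polyop phi -> realizable V -> realizable W ->
  realizable (fun x => [set w | exists u v, [/\ V x u, W x v & w = phi x u v]]).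
Proof.
move=> pphi [m1 [P1 [Q1 [Y1 [cQ1 bY1 VE]]]]] [m2 [P2 [Q2 [Y2 [cQ2 bY2 WE]]]]].
pose X (z : 'rV[R]_(n + (m1 + m2))) : 'rV[R]_n := lsubmx z.
pose X1 (z : 'rV[R]_(n + (m1 + m2))) := row_mx (X z) (lsubmx (rsubmx z)).
pose X2 (z : 'rV[R]_(n + (m1 + m2))) := row_mx (X z) (rsubmx (rsubmx z)).
have pid := @polymap_id R (n + (m1 + m2)).
have pX : polymap X by exact: polymap_lsubmx.
have pX1 : polymap X1.
  by apply: polymap_row_mx => //; apply: polymap_lsubmx; exact: polymap_rsubmx.
have pX2 : polymap X2.
  by apply: polymap_row_mx => //; apply: polymap_rsubmx; exact: polymap_rsubmx.
have pc k (p : poly_in R k) (Z : 'rV[R]_(n + (m1 + m2)) -> 'rV[R]_k) :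
    polymap Z -> polyfun (fun z => peval p (Z z)).
  exact/polyfun_comp/polyfun_peval.
have [P PE] := pphi _ _ _ _ pX (pc _ P1 _ pX1) (pc _ P2 _ pX2).
have [Q QE] := polyfunD (pc _ Q1 _ pX1) (pc _ Q2 _ pX2).
have P2E x y : peval2 P x y = phi x (peval2 P1 x (lsubmx y)) (peval2 P2 x (rsubmx y)).
  by rewrite /peval2 PE /X1 /X2 /X row_mxKl row_mxKr.
have Q2E x y : peval2 Q x y = peval2 Q1 x (lsubmx y) + peval2 Q2 x (rsubmx y).
  by rewrite /peval2 QE /X1 /X2 /X row_mxKl row_mxKr.
pose Y := [set y : 'rV[R]_(m1 + m2) | Y1 (lsubmx y) /\ Y2 (rsubmx y)].
exists (m1 + m2)%N, P, Q, Y; split.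
- move=> x t u v _ _; rewrite convRE !Q2E.
  have h1 := cQ1 x t (lsubmx u) (lsubmx v) (in_setT _) (in_setT _).
  have h2 := cQ2 x t (rsubmx u) (rsubmx v) (in_setT _) (in_setT _).
  move: h1 h2; rewrite !convRE => h1 h2.
  have lE : lsubmx (u <| t |> v : 'rV[R]_(m1 + m2)) =
      t%:num *: lsubmx (u : 'rV[R]_(m1 + m2)) + (1 - t%:num) *: lsubmx v.
    by rewrite -!linearZ -linearD.
  have rE : rsubmx (u <| t |> v : 'rV[R]_(m1 + m2)) =
      t%:num *: rsubmx (u : 'rV[R]_(m1 + m2)) + (1 - t%:num) *: rsubmx v.
    by rewrite -!linearZ -linearD.
  rewrite lE rE !mulrDr addrACA; exact: lerD h1 h2.
- move: bY1 bY2 => [a1 [b1 [ab1 Y1E]]] [a2 [b2 [ab2 Y2E]]].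
  pose a (i : 'I_(m1 + m2)) := match fintype.split i with inl j => a1 j | inr j => a2 j end.
  pose b (i : 'I_(m1 + m2)) := match fintype.split i with inl j => b1 j | inr j => b2 j end.
  exists a, b; split=> [i|]; first by rewrite /a /b; case: fintype.split.
  rewrite /Y Y1E Y2E; apply/seteqP; split=> y /=.
  + move=> [H1 H2] i; rewrite /a /b; case: split_ordP => j ->.
    * by have := H1 j; rewrite mxE.
    * by have := H2 j; rewrite mxE.
  + move=> H; split=> i; rewrite mxE.
    * have := H (lshift m2 i); rewrite /a /b (unsplitK (inl i)) //.
    * have := H (rshift m1 i); rewrite /a /b (unsplitK (inr i)) //.
- move=> x; have argminE y : lower_argmin Q Y x y <->
      lower_argmin Q1 Y1 x (lsubmx y) /\ lower_argmin Q2 Y2 x (rsubmx y).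
    split=> [[[Yl Yr] ymin]|[[Yl lmin] [Yr rmin]]].
    + split; split=> // z Yz.
      * have := ymin (row_mx z (rsubmx y)); rewrite /Y /= !Q2E row_mxKl row_mxKr lerD2r.
        exact.
      * have := ymin (row_mx (lsubmx y) z); rewrite /Y /= !Q2E row_mxKl row_mxKr lerD2l.
        exact.
    + by split=> // z [Zl Zr]; rewrite !Q2E; apply: lerD; [exact: lmin|exact: rmin].
  apply/seteqP; split=> w /=.
  + move=> [u [v [+ + ->]]]; rewrite VE WE => -[y1 ymin1 <-] [y2 ymin2 <-].
    exists (row_mx y1 y2); last by rewrite P2E row_mxKl row_mxKr.
    by apply/argminE; rewrite row_mxKl row_mxKr.
  + move=> [y /argminE[yl yr] <-].
    exists (peval2 P1 x (lsubmx y)), (peval2 P2 x (rsubmx y)).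
    by rewrite VE WE P2E; split=> //; [exists (lsubmx y)|exists (rsubmx y)].
Qed.

(** No lower-level variable is used: the box in dimension 0 is a single point. *)
Lemma realizable_polyfun F : polyfun F -> realizable (fun x => [set F x]).
Proof.
move=> pF; have pX := polymap_lsubmx (@polymap_id R (n + 0)).
have [P PE] := polyfun_comp pF pX.
have [Q QE] := @polyfun_cst R (n + 0) 0.
exists 0%N, P, Q, setT; split.
- by move=> x t u v _ _; rewrite convRE /peval2 QE !mulr0 addr0.
- exists (fun=> 0), (fun=> 0); split=> //.
  by apply/seteqP; split=> // y _ [].
- move=> x; apply/seteqP; split=> w /=.
  + by move=> ->; exists 0; [split=> // z _; rewrite /peval2 QE|rewrite /peval2 PE row_mxKl].
  + by move=> [y _ <-]; rewrite /peval2 PE row_mxKl.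
Qed.

(* These are the minimizers over y in [0, 1] of g(x) y. *)
Lemma realizable_sign g : polyfun g -> realizable (fun x =>
  [set t | [/\ 0 <= t <= 1, 0 < g x -> t = 0 & g x < 0 -> t = 1]]).
Proof.
move=> pg; have pid := @polymap_id R (n + 1).
have [P PE] := @polyfun_coord R (n + 1) (rshift n ord0).
have [Q QE] := polyfunM (polyfun_comp pg (polymap_lsubmx pid)) (polyfun_peval P).
have P2E x y : peval2 P x y = y ord0 ord0 by rewrite /peval2 PE row_mxEr.
have Q2E x y : peval2 Q x y = g x * y ord0 ord0.
  by rewrite /peval2 QE -/(peval2 P x y) P2E row_mxKl.
pose Y := [set y : 'rV[R]_1 | forall i, 0 <= y ord0 i <= 1].
exists 1%N, P, Q, Y; split.
- move=> x t u v _ _; rewrite convRE !Q2E /= !mxE.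
  by rewrite mulrDr mulrCA [g x * (_ * _)]mulrCA.
- by exists (fun=> 0), (fun=> 1); split.
- move=> x; apply/seteqP; split=> t /=.
  + move=> [t01 gpos gneg]; exists (\row__ t); last by rewrite P2E mxE.
    split=> [i|z Yz]; first by rewrite mxE.
    have /andP[z0 z1] := Yz ord0; rewrite !Q2E mxE.
    case: (ltrgtP (g x) 0) => [gx|gx|->]; last by rewrite !mul0r.
    * by rewrite gneg // ler_nM2l.
    * by rewrite gpos // ler_pM2l.
  + move=> [y [Yy ymin] <-]; rewrite P2E; split=> [|gx|gx]; first exact: Yy.
    * have := ymin (\row__ 0); rewrite !Q2E mxE mulr0 pmulr_rle0 // => /(_ _) y0.
      apply/eqP; rewrite eq_le y0 => [|i]; last by rewrite mxE lexx ler01.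
      by have /andP[] := Yy ord0.
    * have := ymin (\row__ 1); rewrite !Q2E mxE ler_nM2l // => /(_ _) y1.
      apply/eqP; rewrite eq_le y1 ?andbT => [|i]; last by rewrite mxE lexx ler01.
      by have /andP[] := Yy ord0.
Qed.

(** Off [D] the value 0 is forced, whereas on [D] the value 1 is merely available: where g(x) = 0, a
    minimizer of g(x) y is free in [0, 1]. *)
Definition closed_indicator D V := [/\ realizable V,
  forall x t, V x t -> 0 <= t <= 1, forall x, V x !=set0,
  forall x, D x -> V x 1 & forall x t, ~ D x -> V x t -> t = 0].

Definition indicator_realizable D := exists V, closed_indicator D V.

Lemma indicator_realizable_le0 g :
  polyfun g -> indicator_realizable [set x | g x <= 0].
Proof.
move=> pg; exists (fun x => [set t | [/\ 0 <= t <= 1, 0 < g x -> t = 0 & g x < 0 -> t = 1]]).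
split; first exact: realizable_sign.
- by move=> x t [].
- move=> x; case: (ltrgtP (g x) 0) => gx; [exists 1|exists 0|exists 0];
    by split=> //; rewrite ?lexx ?ler01 // => h; exfalso; move: h; rewrite ?gx ltNge ?ltW // lexx.
- by move=> x /= gx; split; rewrite ?lexx ?ler01 // => h; exfalso; move: h; rewrite ltNge gx.
- by move=> x t /negP; rewrite -ltNge => gx [_ /(_ gx)].
Qed.

Lemma polyop_mul : polyop (fun _ u v => u * v).
Proof. by move=> k X U W _; exact: polyfunM. Qed.

Lemma indicator_realizableI D E : indicator_realizable D ->
  indicator_realizable E -> indicator_realizable (D `&` E).
Proof.
move=> [V [rV V01 V0 VD VnD]] [W [rW W01 W0 WD WnD]].
exists (fun x => [set w | exists u v, [/\ V x u, W x v & w = u * v]]); split.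
- exact: (realizable2 polyop_mul).
- move=> x t [u [v [/V01/andP[u0 u1] /W01/andP[v0 v1] ->]]].
  by rewrite mulr_ge0 //= mulr_ile1.
- by move=> x; have [u Vu] := V0 x; have [v Wv] := W0 x; exists (u * v), u, v.
- by move=> x [Dx Ex]; exists 1, 1; rewrite mulr1; split; [exact: VD|exact: WD|].
- move=> x t /not_andP[nD|nE] [u [v [Vu Wv ->]]].
  + by rewrite (VnD x u) // mul0r.
  + by rewrite (WnD x v) // mulr0.
Qed.

(** u + v - u v = 1 - (1 - u)(1 - v) is 1 as soon as [u] or [v] is 1, and 0 when both vanish. *)
Lemma indicator_realizableU D E : indicator_realizable D ->
  indicator_realizable E -> indicator_realizable (D `|` E).
Proof.
move=> [V [rV V01 V0 VD VnD]] [W [rW W01 W0 WD WnD]].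
pose phi (_ : 'rV[R]_n) (u v : R) := u + v - u * v.
have pphi : polyop phi.
  by move=> k X U T _ pU pT; apply: polyfunB; [exact: polyfunD|exact: polyfunM].
exists (fun x => [set w | exists u v, [/\ V x u, W x v & w = phi x u v]]); split.
- exact: realizable2.
- move=> x t [u [v [/V01/andP[u0 u1] /W01/andP[v0 v1] ->]]].
  by rewrite /phi; apply/andP; split; nra.
- by move=> x; have [u Vu] := V0 x; have [v Wv] := W0 x; exists (phi x u v), u, v.
- move=> x [Dx|Ex].
  + by have [v Wv] := W0 x; exists 1, v; split; [exact: VD| |rewrite /phi; ring].
  + by have [u Vu] := V0 x; exists u, 1; split; [|exact: WD|rewrite /phi; ring].
- move=> x t /not_orP[nD nE] [u [v [Vu Wv ->]]].
  by rewrite /phi (VnD x u) // (WnD x v) //; ring.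
Qed.

(** The complement is a finite union of sets where finitely many [q] are positive, so [D] is a
    finite intersection of finite unions of sets [q <= 0]. *)
Lemma indicator_realizable_closed D :
  closed D -> semialgebraic D -> indicator_realizable D.
Proof.
move=> clD sD; have [|s sE] := open_semialgebraic (semialgebraicC sD).
  by rewrite openC.
have -> : D = [set x | ~~ has (fun qs => all (fun q => 0 < peval q x) qs) s].
  apply/seteqP; split=> x /=; first by move=> Dx; apply/negP => /sE; exact.
  by move=> /negP nx; apply: contrapT => /sE.
(* The empty intersection and the empty union come from the constants 0 and 1 taken as [g]. *)
have cst (b : bool) : indicator_realizable [set x | b].
  have -> : [set x : 'rV[R]_n | b] = [set x | (if b then 0 else 1 : R) <= 0].
    by case: b; apply/seteqP; split=> x //=; rewrite ?lexx // ler10.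
  exact/indicator_realizable_le0/polyfun_cst.
elim: s {sE} => [|qs s ih]; first exact: cst.
rewrite (_ : [set _ | _] = [set x | ~~ all (fun q => 0 < peval q x) qs] `&`
    [set x | ~~ has (fun qs => all (fun q => 0 < peval q x) qs) s]); last first.
  by apply/seteqP; split=> x /=; rewrite negb_or => /andP.
apply: indicator_realizableI ih; elim: qs => [|q qs ih]; first exact: cst.
rewrite (_ : [set _ | _] = [set x | peval q x <= 0] `|`
    [set x | ~~ all (fun q => 0 < peval q x) qs]); last first.
  by apply/seteqP; split=> x /=; rewrite negb_and -leNgt => /orP.
apply: indicator_realizableU ih; exact/indicator_realizable_le0/polyfun_peval.
Qed.

(* Multiplying by a free variable of [0, 1] makes 0 available on D too. *)
Lemma switch_realizable D : indicator_realizable D -> exists W,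
  [/\ realizable W, forall x t, W x t -> 0 <= t <= 1, forall x, W x 0,
      forall x, D x -> W x 1 & forall x t, ~ D x -> W x t -> t = 0].
Proof.
move=> [V [rV V01 V0 VD VnD]].
have rU := realizable_sign (polyfun_cst n 0).
exists (fun x => [set w | exists u v,
  [/\ V x u, [set t : R | [/\ 0 <= t <= 1, 0 < 0 :> R -> t = 0 & 0 < 0 :> R -> t = 1]] v
    & w = u * v]]); split.
- exact: (realizable2 polyop_mul).
- move=> x t [u [v [/V01/andP[u0 u1] [/andP[v0 v1] _ _] ->]]].
  by rewrite mulr_ge0 //= mulr_ile1.
- move=> x; have [u Vu] := V0 x; exists u, 0; rewrite mulr0; split=> //.
  by split; rewrite ?ltxx // lexx ler01.
- move=> x /VD V1; exists 1, 1; rewrite mulr1; split=> //.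
  by split; rewrite ?ltxx // lexx ler01.
- by move=> x t nD [u [v [/(VnD _ _ nD) -> _ ->]]]; rewrite mul0r.
Qed.

Lemma lower_semicontinuous_lt_open (f F : 'rV[R]_n -> R) :
  lower_semicontinuous (EFin \o f) -> continuous F -> open [set x | F x < f x].
Proof.
move=> lf cF; rewrite openE => x /= Ffx.
(* Near [x], continuity keeps [F] below the midpoint and semicontinuity keeps [f] above it. *)
pose a := (F x + f x) / 2.
have Fa : F x < a by rewrite /a; lra.
have af : a < f x by rewrite /a; lra.
have [|V Vx VE] := lf x a; first by rewrite /= lte_fin.
rewrite /interior; near=> y.
have : (a%:E < (f y)%:E)%E by apply: VE; near: y.
rewrite lte_fin => afy; apply: lt_trans afy; near: y.
exact: (cvgr_lt (F x) (cF x) _ Fa).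
Unshelve. all: by end_near. Qed.

Lemma piecewise_lsc_realizable (f : 'rV[R]_n -> R) :
  piecewise_polynomial f -> lower_semicontinuous (EFin \o f) ->
  exists V, [/\ realizable V, forall x v, V x v -> f x <= v & forall x, V x (f x)].
Proof.
move=> [N [S [P [[coverS _ _] sS fP]]]] lf.
have Sx x : exists i, S i x.
  by have : [set: 'rV[R]_n] x by []; rewrite -coverS => -[i _]; exists i.
(* Semicontinuity makes D i closed; it contains S i, so that f is the minimum of
   the P i over the indices i with x in D i. *)
pose D i := [set x | f x <= peval (P i) x].
have rD i : indicator_realizable (D i).
  have DE : D i = ~` [set x | peval (P i) x < f x].
    by apply/seteqP; split=> x /=; rewrite /D /= leNgt => /negP.
  apply: indicator_realizable_closed.
    rewrite DE closedC; apply: lower_semicontinuous_lt_open => //.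
    exact/polyfun_continuous/polyfun_peval.
  (* [D i] is the union over [k] of the parts of [S k] where P_k <= P_i. *)
  have := semialgebraic_exists (fun k => semialgebraicI (sS k)
    (semialgebraic_le (polyfun_peval (P k)) (polyfun_peval (P i)))).
  congr semialgebraic; apply/seteqP; split=> x /=.
    by move=> [k [Skx /=]]; rewrite /D /= (fP k).
  by rewrite /D /=; have [k Skx] := Sx x; exists k; split=> //=; rewrite -fP.
(* Induction on the pieces treated: all values stay above [f], and [f x] is attained on the pieces
   in [L]. *)
suff H (L : seq 'I_N) : exists V, [/\ realizable V, forall x v, V x v -> f x <= v,
    forall x, V x !=set0 & forall i x, i \in L -> S i x -> V x (f x)].
  have [V [rV Vge _ VS]] := H (enum 'I_N); exists V; split=> // x.
  by have [i Six] := Sx x; apply: VS Six; rewrite mem_enum.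
elim: L => [|i L [V [rV Vge V0 VS]]].
  (* The value returned when no switch is on: any polynomial above f will do. *)
  pose M x := 1 + \sum_(j < N) peval (P j) x ^+ 2.
  exists (fun x => [set M x]); split=> //; last by move=> x; exists (M x).
    apply/realizable_polyfun/polyfunD; first exact: polyfun_cst.
    by apply: polyfun_sum => j; exact/polyfunX/polyfun_peval.
  move=> x _ ->; have [j Sjx] := Sx x; rewrite (fP j) //.
  have : 1 + peval (P j) x ^+ 2 <= M x.
    by rewrite lerD2l (bigD1 j) //= lerDl sumr_ge0 // => k _; exact: sqr_ge0.
  by apply: le_trans; nra.
have [W [rW W01 W0 WD WnD]] := switch_realizable (rD i).
pose phi x u v := v + u * (peval (P i) x - v).
have pphi : polyop phi.
  move=> k X U T pX pU pT; apply: polyfunD => //; apply: polyfunM => //.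
  by apply: polyfunB => //; apply: polyfun_comp pX; exact: polyfun_peval.
exists (fun x => [set w | exists u v, [/\ W x u, V x v & w = phi x u v]]); split.
- exact: realizable2.
(* On [D i] the new value is a convex combination of [v] and P_i(x), both at least f(x); off [D i]
   it is [v]. *)
- move=> x w [u [v [Wu /Vge fv ->]]]; rewrite /phi.
  have [Dx|nDx] := pselect (D i x); last by rewrite (WnD _ _ nDx Wu) mul0r addr0.
  have /andP[u0 u1] := W01 _ _ Wu; rewrite /D /= in Dx; nra.
- by move=> x; have [v Vv] := V0 x; exists (phi x 0 v), 0, v.
(* The choice u = 1 selects P_i on [S i]; u = 0 keeps the value obtained for an earlier piece. *)
- move=> j x; rewrite inE => /orP[/eqP -> Six|jL Sjx].
    have [v Vv] := V0 x; exists 1, v; split=> //; first by apply: WD; rewrite /D /= (fP i).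
    by rewrite /phi (fP i) //; ring.
  by exists 0, (f x); split=> //; [exact: VS jL Sjx|rewrite /phi mul0r addr0].
Qed.

Lemma PP_LSC_C_optim_bounded : @PP R n `&` @LSC R n `<=` @C_optim_bounded R n.
Proof.
move=> h [[f pf ->]] lf; have [V [[m [P [Q [Y [cQ bY VE]]]]] Vge Vf]] :=
  piecewise_lsc_realizable pf lf.
exists m, P, Q, Y; split=> //; apply/funext => x /=; rewrite /optimistic_value.
apply/eqP; rewrite eq_le; apply/andP; split.
  by apply: ereal_inf_lbound; have := Vf x; rewrite VE => -[y ymin <-]; exists y.
apply: le_ereal_inf_tmp => _ [y ymin <-]; rewrite lee_fin; apply: Vge.
by rewrite VE; exists y.
Qed.

End Realizable.

(** * Regularity of value functions *)

Section ValueFunction.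
Context {R : realType} {n m : nat}.
Variables (P Q : poly_in R (n + m)) (Y : set 'rV[R]_m).
Hypothesis bY : bounded_box Y.

Lemma bounded_box_compact : compact Y.
Proof. by move: bY => [a [b [_ ->]]]; exact: compact_box. Qed.

Lemma bounded_box_nonempty : Y !=set0.
Proof.
move: bY => [a [b [ab ->]]]; exists (\row_i a i) => i.
by rewrite mxE lexx ab.
Qed.

Lemma polyfun_peval2r (p : poly_in R (n + m)) x : polyfun (peval2 p x).
Proof.
apply: polyfun_comp; first exact: polyfun_peval.
by apply: polymap_row_mx; [exact: polymap_cst|exact: polymap_id].
Qed.

(** The pair is ordered (y, x) to match the covering argument on the box, where the point of the
    compact set comes first. *)
Lemma peval2_continuous (p : poly_in R (n + m)) :
  continuous (fun z : 'rV[R]_m * 'rV[R]_n => peval2 p z.2 z.1).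
Proof.
rewrite /peval2; have := polyfun_peval p; move: (peval p) => F.
move: F; apply: polyfun_ind => [c|i|F G cF cG|F G cF cG] z.
- exact: cst_continuous.
- case: (split_ordP i) => j ->.
  + rewrite (_ : (fun _ => _) = (fun x : 'rV[R]_n => x ord0 j) \o snd); last first.
      by apply/funext => w; rewrite /= row_mxEl.
    by apply: continuous_comp; [exact: cvg_snd|exact: coord_continuous].
  + rewrite (_ : (fun _ => _) = (fun x : 'rV[R]_m => x ord0 j) \o fst); last first.
      by apply/funext => w; rewrite /= row_mxEr.
    by apply: continuous_comp; [exact: cvg_fst|exact: coord_continuous].
- by apply: continuousD; [exact: cF|exact: cG].
- by apply: continuousM; [exact: cF|exact: cG].
Qed.

Lemma polyfun_min_on (p : poly_in R (n + m)) x (K : set 'rV[R]_m) :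
  compact K -> K !=set0 ->
  exists2 y, K y & forall z, K z -> peval2 p x y <= peval2 p x z.
Proof.
move=> cK K0; have [|y /set_mem Ky ymin] := EVT_min_rV K0 cK (f := peval2 p x).
  exact/continuous_subspaceT/polyfun_continuous/polyfun_peval2r.
by exists y => // z Kz; apply: ymin; exact/mem_set.
Qed.

Lemma optimistic_value_attained x : exists y, [/\ lower_argmin Q Y x y,
  forall z, lower_argmin Q Y x z -> peval2 P x y <= peval2 P x z
  & optimistic_value P Q Y x = (peval2 P x y)%:E].
Proof.
have [y0 Yy0 y0min] := polyfun_min_on Q x bounded_box_compact bounded_box_nonempty.
have cT : compact (lower_argmin Q Y x).
  (* Given one minimizer [y0], the argmin is a closed sublevel set inside the compact box. *)
  have -> : lower_argmin Q Y x = [set y | peval2 Q x y <= peval2 Q x y0] `&` Y.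
    apply/seteqP; split=> y [].
    + by move=> Yy ymin; split=> //; exact: ymin.
    + by move=> /= yy0 Yy; split=> // z /y0min; exact: le_trans.
  apply: (subclosed_compact _ bounded_box_compact); last by move=> y [].
  apply: closedI; last exact: (compact_closed (@norm_hausdorff _ _) bounded_box_compact).
  by apply: closed_polyfun_le; [exact: polyfun_peval2r|exact: polyfun_cst].
have [|y Ty ymin] := polyfun_min_on P x cT; first by exists y0.
exists y; split=> //; apply/eqP; rewrite eq_le; apply/andP; split.
  by apply: ereal_inf_lbound; exists y.
by apply: le_ereal_inf_tmp => _ [z Tz <-]; rewrite lee_fin; exact: ymin.
Qed.

(** Attainment turns the infimum into a first-order condition, to which projection and complement
    apply. *)
Lemma optimistic_value_eq x (t : R) : optimistic_value P Q Y x = t%:E <->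
  (exists y, lower_argmin Q Y x y /\ peval2 P x y = t) /\
  ~ (exists y, lower_argmin Q Y x y /\ peval2 P x y < t).
Proof.
have [y [Ty ymin ->]] := optimistic_value_attained x; split=> [[<-]|].
  by split; [exists y|move=> [z [/ymin + zlt]]; rewrite leNgt zlt].
move=> [[z [Tz <-]] nz]; congr EFin; apply/eqP; rewrite eq_le ymin //= leNgt.
by apply/negP => yz; apply: nz; exists y.
Qed.

Lemma semialgebraic_lower_argmin :
  semialgebraic [set z : 'rV[R]_(n + m) | lower_argmin Q Y (lsubmx z) (rsubmx z)].
Proof.
have sY : semialgebraic Y.
  move: bY => [a [b [_ ->]]]; apply: semialgebraic_forall => i.
  have := semialgebraicI (semialgebraic_le (polyfun_cst _ (a i)) (polyfun_coord i))
    (semialgebraic_le (polyfun_coord i) (polyfun_cst _ (b i))).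
  by congr semialgebraic; apply/seteqP; split=> x /andP.
have pid := @polymap_id R (n + m); have pid2 := @polymap_id R (n + m + m).
(* Triples (x, y, z) in which [z] in the box beats [y]; the argmin is the complement, within the
   box, of the projection of [B] to (x, y). *)
pose B := [set w : 'rV[R]_(n + m + m) | Y (rsubmx w)] `&`
  [set w | peval2 Q (lsubmx (lsubmx w)) (rsubmx w) < peval Q (lsubmx w)].
have sB : semialgebraic B.
  apply: semialgebraicI.
    by apply: semialgebraic_preimage sY; exact: polymap_rsubmx.
  apply: semialgebraic_lt; apply: polyfun_comp (polyfun_peval Q) _.
    apply: polymap_row_mx; last exact: polymap_rsubmx.
    by apply: polymap_lsubmx; exact: polymap_lsubmx.
  exact: polymap_lsubmx.
have := semialgebraicI (semialgebraic_preimage (polymap_rsubmx pid) sY)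
  (semialgebraicC (semialgebraic_proj sB)).
congr semialgebraic; apply/seteqP; split=> z /=.
- move=> [Yz nB]; split=> // y Yy; rewrite leNgt; apply/negP => lt_y.
  apply: nB; exists y; rewrite /B /= row_mxKr !row_mxKl; split=> //.
  by move: lt_y; rewrite /peval2 hsubmxK.
- move=> [Yz zmin]; split=> // -[y []]; rewrite /= row_mxKr !row_mxKl => /zmin.
  by rewrite {1}/peval2 hsubmxK leNgt => /negP.
Qed.

Lemma semialgebraic_value_graph :
  semialgebraic [set z : 'rV[R]_(n + 1) |
    optimistic_value P Q Y (lsubmx z) = (rsubmx z ord0 ord0)%:E].
Proof.
have pid := @polymap_id R (n + 1 + m).
pose X (w : 'rV[R]_(n + 1 + m)) := row_mx (lsubmx (lsubmx w)) (rsubmx w).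
have pX : polymap X.
  apply: polymap_row_mx; last exact: polymap_rsubmx.
  by apply: polymap_lsubmx; exact: polymap_lsubmx.
pose t (w : 'rV[R]_(n + 1 + m)) := rsubmx (lsubmx w) ord0 ord0.
have pt : polyfun t by apply: polymap_rsubmx; exact: polymap_lsubmx.
have sT := semialgebraic_preimage pX semialgebraic_lower_argmin.
have pP := polyfun_comp (polyfun_peval P) pX.
have := semialgebraicI (semialgebraic_proj (semialgebraicI sT (semialgebraic_eq pP pt)))
  (semialgebraicC (semialgebraic_proj (semialgebraicI sT (semialgebraic_lt pP pt)))).
congr semialgebraic; apply/seteqP; split=> z /=; rewrite optimistic_value_eq.
- rewrite /X /t; move=> [[y]]; rewrite /= !row_mxKl !row_mxKr => -[Ty Py] nz.
  split; first by exists y.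
  move=> [y' Ty']; apply: nz; exists y'; by rewrite /= !row_mxKl !row_mxKr.
- rewrite /X /t; move=> [[y [Ty Py]] nz]; split.
    by exists y; rewrite /= !row_mxKl !row_mxKr.
  move=> [y']; rewrite /= !row_mxKl !row_mxKr => Ty'; by apply: nz; exists y'.
Qed.

(** Each [y] in the box is either a solution at [x], and then P > a around (y, x), or beaten by some
    [z], and then nearby points are beaten by the same [z] and are not solutions. Compactness makes
    the neighbourhood of [x] uniform in [y]. *)
Lemma optimistic_value_lsc : lower_semicontinuous (optimistic_value P Q Y).
Proof.
move=> x a; have [y0 [_ y0min ->]] := optimistic_value_attained x; rewrite lte_fin => ay0.
have near_gt : \forall x' \near x,
    Y `<=` (fun y => lower_argmin Q Y x' y -> a < peval2 P x' y).
  have ncY : near_covering Y by apply/compact_near_coveringP; exact: bounded_box_compact.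
  apply: (ncY _ (nbhs x)
    (fun x' y => lower_argmin Q Y x' y -> a < peval2 P x' y)) => y Yy.
  have [Ty|nTy] := pselect (lower_argmin Q Y x y).
    have aPy : a < peval2 P x y := lt_le_trans ay0 (y0min _ Ty).
    by apply: filterS _ (cvgr_gt _ (@peval2_continuous P (y, x)) _ aPy) => z aPz _.
  have [z [Yz zy]] : exists z, Y z /\ peval2 Q x z < peval2 Q x y.
    apply: contrapT => nz; apply: nTy; split=> // z Yz; rewrite leNgt; apply/negP => zy.
    by apply: nz; exists z.
  have pQz : polyfun (fun x' => peval2 Q x' z).
    apply: polyfun_comp; first exact: polyfun_peval.
    by apply: polymap_row_mx; [exact: polymap_id|exact: polymap_cst].
  have cD : continuous (fun w : 'rV[R]_m * 'rV[R]_n => peval2 Q w.2 w.1 - peval2 Q w.2 z).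
    move=> w; apply: cvgB; first exact: peval2_continuous.
    apply: (@continuous_comp _ _ _ snd (fun x' => peval2 Q x' z)); first exact: cvg_snd.
    exact: polyfun_continuous.
  have D0 : 0 < peval2 Q x y - peval2 Q x z by rewrite subr_gt0.
  apply: filterS _ (cvgr_gt _ (cD (y, x)) _ D0) => -[y' x'] /=.
  by rewrite subr_gt0 ltNge => /negP + [_ /(_ z Yz)].
exists [set x' | Y `<=` (fun y => lower_argmin Q Y x' y -> a < peval2 P x' y)] => // x' /= gtY.
have [y [Ty _ ->]] := optimistic_value_attained x'.
by rewrite lte_fin; apply: gtY => //; case: Ty.
Qed.

(** The value is P(x, y) at some [y] of the box; for x in a compact set, all coordinates of (x, y)
    are bounded, hence so is P. *)
Lemma optimistic_value_CB : CB (optimistic_value P Q Y).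
Proof.
have [f fP] := choice optimistic_value_attained.
exists (fun x => peval2 P x (f x)).
  by apply/funext => x; have [_ _ ->] := fP x.
move=> K cK.
have [b Kb] : exists b, forall x, K x -> sqnorm1 x <= b.
  have [K0|/nonemptyPn K0] := pselect (K !=set0); last by exists 0 => x; rewrite K0.
  have [|y _ ymax] := EVT_max_rV K0 cK (f := @sqnorm1 R n).
    exact/continuous_subspaceT/polyfun_continuous/polyfun_sqnorm1.
  by exists (sqnorm1 y) => x Kx; apply: ymax; exact/mem_set.
have [c Yc] : exists c, forall y, Y y -> forall i, `|y ord0 i| <= c.
  have [|y _ ymax] := EVT_max_rV bounded_box_nonempty bounded_box_compact (f := @sqnorm1 R m).
    exact/continuous_subspaceT/polyfun_continuous/polyfun_sqnorm1.
  exists (sqnorm1 y) => z /mem_set /ymax zy i; apply: le_trans zy.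
  by rewrite ler_norml sqnorm1_coord.
have [M PM] := polyfun_bounded (Num.max b c) (polyfun_peval P).
exists M => x Kx; apply: PM => i; rewrite le_max; case: (split_ordP i) => j ->.
- rewrite row_mxEl; apply/orP; left; apply: le_trans (Kb _ Kx).
  by rewrite ler_norml sqnorm1_coord.
- by rewrite row_mxEr; apply/orP; right; apply: Yc; have [[]] := fP x.
Qed.

End ValueFunction.

(** * The inclusions *)

Section Classes.
Context {R : realType} {n : nat}.
Local Open Scope ereal_scope.
Implicit Types h : 'rV[R]_n -> \bar R.

Lemma C_optim_bounded_sub :
  @C_optim_bounded R n `<=` @SA R n `&` @LSC R n `&` @CB R n.
Proof.
move=> _ [m [P [Q [Y [_ bY <-]]]]]; split; last exact: optimistic_value_CB.
split; last exact: optimistic_value_lsc.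
have [f fE] : exists f, forall x, optimistic_value P Q Y x = (f x)%:E.
  by have [f -> _] := optimistic_value_CB P Q bY; exists f.
split; first exact: semialgebraic_value_graph.
- rewrite (_ : [set _ | _] = set0); first exact: semialgebraic0.
  by apply/seteqP; split=> x //=; rewrite fE.
- rewrite (_ : [set _ | _] = set0); first exact: semialgebraic0.
  by apply/seteqP; split=> x //=; rewrite fE.
Qed.

(** The lower level is untouched; only the upper objective changes sign, which exchanges supremum
    and infimum. *)
Lemma pessimistic_valueE m (P P' Q : poly_in R (n + m)) Y :
  (forall x y, peval2 P' x y = - peval2 P x y)%R ->
  pessimistic_value P Q Y = fun x => - optimistic_value P' Q Y x.
Proof.
move=> P'E; apply/funext => x.
rewrite /pessimistic_value /optimistic_value ereal_infEN oppeK; congr ereal_sup.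
apply/seteqP; split=> u /=.
- move=> [y Ty <-]; exists (peval2 P' x y)%:E; first by exists y.
  by rewrite P'E EFinN oppeK.
- by move=> [_ [y Ty <-] <-]; exists y; rewrite // P'E EFinN oppeK.
Qed.

Lemma poly_oppE m (P : poly_in R (n + m)) :
  exists P', forall x y, (peval2 P' x y = - peval2 P x y)%R.
Proof.
have [P' P'E] := polyfunN (polyfun_peval P).
by exists P' => x y; rewrite /peval2 P'E.
Qed.

Lemma C_pessim_boundedN h :
  C_pessim_bounded h <-> C_optim_bounded (fun x => - h x).
Proof.
split=> -[m [P [Q [Y [cQ bY hE]]]]]; have [P' P'E] := poly_oppE P.
- exists m, P', Q, Y; split=> //; rewrite -hE (pessimistic_valueE _ _ P'E).
  by apply/funext => x; rewrite oppeK.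
- exists m, P', Q, Y; split=> //.
  rewrite (@pessimistic_valueE _ P' P) => [|x y]; last by rewrite P'E opprK.
  by rewrite hE; apply/funext => x; rewrite oppeK.
Qed.

Lemma PPN h : PP h -> PP (fun x => - h x).
Proof.
move=> [f [N [S [P [pS sS fP]]]] ->]; exists (fun x => - f x)%R => //.
have /choice[P' P'E] i : exists p, peval p = (fun x => - peval (P i) x)%R.
  exact: polyfunN (polyfun_peval (P i)).
by exists N, S, P'; split=> // i x Six; rewrite P'E (fP i).
Qed.

Lemma USC_oppe_LSC h : USC h -> LSC (fun x => - h x).
Proof.
move=> uh x a ahx; have [|V Vx VP] := uh x (- a)%R; first by rewrite EFinN lteNr.
by exists V => // y /VP; rewrite EFinN lteNr.
Qed.

Lemma LSC_oppe_USC h : LSC (fun x => - h x) -> USC h.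
Proof.
move=> lh x a hxa; have [|V Vx VP] := lh x (- a)%R; first by rewrite EFinN lteN2.
by exists V => // y /VP; rewrite EFinN lteN2.
Qed.

(** The graph is reflected by (x, t) -> (x, -t), and the places of the two infinite values are
    exchanged. *)
Lemma SA_oppe h : SA (fun x => - h x) -> SA h.
Proof.
move=> [sG sp sm]; split.
- pose X (z : 'rV[R]_(n + 1)) : 'rV[R]_(n + 1) :=
    row_mx (lsubmx z) (\row__ (- rsubmx z ord0 ord0))%R.
  have pid := @polymap_id R (n + 1).
  have pX : polymap X.
    apply: polymap_row_mx; first exact: polymap_lsubmx.
    move=> i; apply: eq_polyfun (polyfunN (polymap_rsubmx pid ord0)) _ => z.
    by rewrite [RHS]mxE.
  have XE z : rsubmx (X z) ord0 ord0 = (- rsubmx z ord0 ord0)%R.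
    by rewrite row_mxKr [LHS]mxE.
  have := semialgebraic_preimage pX sG; congr semialgebraic.
  apply/seteqP; split=> z /=; rewrite XE /X row_mxKl EFinN.
  + exact: oppe_inj.
  + by move=> ->.
- move: sm; congr semialgebraic; apply/seteqP; split=> x /=.
  + by move=> /eqP; rewrite eqe_oppLR => /eqP.
  + by move=> ->.
- move: sp; congr semialgebraic; apply/seteqP; split=> x /=.
  + by move=> /eqP; rewrite eqe_oppLR => /eqP.
  + by move=> ->.
Qed.

Lemma CB_oppe h : CB (fun x => - h x) -> CB h.
Proof.
move=> [f hf fb]; exists (fun x => - f x)%R.
  apply/funext => x; have /(congr1 (fun g => g x)) /= := hf.
  by move=> /(congr1 oppe); rewrite oppeK.
by move=> K /fb[M fM]; exists M => x /fM; rewrite normrN.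
Qed.

End Classes.

Theorem theorem2p20 (R : realType) (n : nat) :
  [/\ @PP R n `&` @LSC R n `<=` @C_optim_bounded R n,
      @C_optim_bounded R n `<=` @SA R n `&` @LSC R n `&` @CB R n,
      @PP R n `&` @USC R n `<=` @C_pessim_bounded R n
    & @C_pessim_bounded R n `<=` @SA R n `&` @USC R n `&` @CB R n].
Proof.
split.
- exact: PP_LSC_C_optim_bounded.
- exact: C_optim_bounded_sub.
- move=> h [/PPN ph /USC_oppe_LSC lh]; apply/C_pessim_boundedN.
  exact: PP_LSC_C_optim_bounded.
- move=> h /C_pessim_boundedN /C_optim_bounded_sub[[sh lh] ch].
  by split; [split; [exact: SA_oppe|exact: LSC_oppe_USC]|exact: CB_oppe].
Qed.
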